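(* Let $\Gamma$ be a subset of $\mathbb{C}$ and let $\mathscr{F}$ be a hypercyclicity set. Consider the following conditions: (i) $\Gamma \setminus \{0\}$ is non-empty, bounded, and bounded away from zero. (ii) $\Gamma$ is an $\mathscr{F}$-hypercyclic scalar set. (iii) $\Gamma \setminus \{0\}$ is non-empty, bounded, and $\mathcal{C}_0(\Gamma) \subset \mathcal{R}(\Gamma)$. Then the implication (ii) $\Rightarrow$ (iii) always holds. Furthermore, if $\mathscr{F}$ is right-invariant and $\mathscr{P}(\mathbb{N}_0) \setminus \mathscr{F}$ is closed under finite unions, then (i) $\Rightarrow$ (ii) also holds.
   Context: $\mathbb{N}_0=\{0,1,2,\dots\}$ and $\mathscr{P}(\mathbb{N}_0)$ is the family of all subsets of $\mathbb{N}_0$. All Banach spaces are complex, separable and infinite-dimensional; operators are bounded and linear. A Furstenberg family is a family $\mathscr{F}\subset\mathscr{P}(\mathbb{N}_0)$ with $\emptyset\notin\mathscr{F}\neq\emptyset$ that is hereditarily upward: if $E\subset F\subset\mathbb{N}_0$ and $E\in\mathscr{F}$, then $F\in\mathscr{F}$. A hypercyclicity set is a Furstenberg family $\mathscr{F}$ for which there exists a sequence $(A_k)_{k\geq1}$ of pairwise disjoint sets in $\mathscr{F}$ such that for any $j\in A_k$ and $j'\in A_{k'}$ with $j\neq j'$ we have $|j-j'|\geq\max\{k,k'\}$. $\mathscr{F}$ is right-invariant if, for any $E\in\mathscr{P}(\mathbb{N}_0)$, $E\in\mathscr{F}$ if and only if $p+E\in\mathscr{F}$ for every $p\in\mathbb{N}_0$.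 For $\Gamma\subset\mathbb{C}$ and an operator $T$ on $X$, a vector $x\in X$ is an $\mathscr{F}_\Gamma$-hypercyclic vector for $T$ if $\{n\in\mathbb{N}_0: T^n(\Gamma x)\cap U\neq\emptyset\}\in\mathscr{F}$ for every non-empty open $U\subset X$, where $\Gamma x=\{\lambda x:\lambda\in\Gamma\}$. $\Gamma$ is an $\mathscr{F}$-hypercyclic scalar set if, for every Banach space $Y$, every operator $S$ on $Y$ and every $y\in Y$, $y$ is an $\mathscr{F}_\Gamma$-hypercyclic vector for $S$ if and only if $y$ is an $\mathscr{F}_{\{1\}}$-hypercyclic vector for $S$. Moreover $\mathcal{C}_0(\Gamma):=\{(\alpha_k)_{k\geq0}\subset\Gamma: (|\alpha_k|)_k \text{ is strictly decreasing and converges to } 0\}$ and $\mathcal{R}(\Gamma):=\{(\alpha_k)_{k\geq0}\subset\Gamma\setminus\{0\}:\lim_{k\to\infty}|\alpha_{k+1}|/|\alpha_k|=0\}$. *)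

(* Defs.v *)
From HB Require Import structures.
From mathcomp Require Import all_boot all_order all_algebra.
From mathcomp Require Import all_classical all_reals all_analysis.
From mathcomp Require Import complex.
Import Order.TTheory GRing.Theory Num.Theory.
Import numFieldNormedType.Exports.

Set Implicit Arguments.
Unset Strict Implicit.
Unset Printing Implicit Defensive.

Local Open Scope classical_set_scope.
Local Open Scope ring_scope.
Local Open Scope complex_scope.

(* The norm `|z| of z : R[i] lives in R[i]; this is the modulus as an element
   of R, so that order and limits are those of the real numbers. *)
Notation modulus := ComplexField.Normc.normc.

Definition furstenberg_family (F : set (set nat)) : Prop :=
  [/\ ~ F set0, F !=set0
    & forall E E' : set nat, E `<=` E' -> F E -> F E'].

(* The sequence (A_k) is indexed by k >= 1; the value A 0 is irrelevant. *)
Definition hypercyclicity_set (F : set (set nat)) : Prop :=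
  furstenberg_family F /\
  exists A : nat -> set nat,
    [/\ forall k : nat, (1 <= k)%N -> F (A k),
        trivIset [set k : nat | (1 <= k)%N] A
      & forall k k' j j' : nat, (1 <= k)%N -> (1 <= k')%N ->
          A k j -> A k' j' -> j <> j' -> (maxn k k' <= `|j - j'|)%N].

Definition right_invariant (F : set (set nat)) : Prop :=
  forall E : set nat, F E <-> forall p : nat, F (addn p @` E).

Definition finite_union_closed (G : set (set nat)) : Prop :=
  forall (n : nat) (E : nat -> set nat),
    (forall i : nat, (i < n)%N -> G (E i)) -> G (\bigcup_(i < n) E i).

Definition separable (T : topologicalType) : Prop :=
  exists2 D : set T, countable D & dense D.

Definition infinite_dimensional (K : fieldType) (V : lmodType K) : Prop :=
  forall (n : nat) (e : 'I_n -> V),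
    ~ (forall v : V, exists c : 'I_n -> K, v = \sum_(i < n) c i *: e i).

Definition bounded_operator (R : realType) (X : normedModType R[i])
    (T : {linear X -> X}) : Prop :=
  exists M : R, forall x : X, `|T x| <= M%:C * `|x|.

Definition hypercyclic_vector (R : realType) (F : set (set nat))
    (Gamma : set R[i]) (X : normedModType R[i]) (T : {linear X -> X})
    (x : X) : Prop :=
  forall U : set X, open U -> U !=set0 ->
    F [set n : nat |
        (iter n T @` [set lambda *: x | lambda in Gamma]) `&` U !=set0].

Definition hypercyclic_scalar_set (R : realType) (F : set (set nat))
    (Gamma : set R[i]) : Prop :=
  forall Y : completeNormedModType R[i],
    separable Y -> infinite_dimensional Y ->
  forall S : {linear Y -> Y}, bounded_operator S ->
  forall y : Y,
    hypercyclic_vector F Gamma S y <-> hypercyclic_vector F [set 1] S y.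

Definition modulus_bounded (R : realType) (A : set R[i]) : Prop :=
  exists M : R, forall z : R[i], A z -> modulus z <= M.

Definition modulus_bounded_away_from_zero (R : realType) (A : set R[i])
    : Prop :=
  exists2 m : R, 0 < m & forall z : R[i], A z -> m <= modulus z.

Definition calC0 (R : realType) (Gamma : set R[i]) : set (nat -> R[i]) :=
  [set alpha | [/\ forall k : nat, Gamma (alpha k),
     forall k : nat, modulus (alpha k.+1) < modulus (alpha k)
   & (fun k : nat => modulus (alpha k)) @ \oo --> (0 : R)]].

Definition calR (R : realType) (Gamma : set R[i]) : set (nat -> R[i]) :=
  [set alpha | (forall k : nat, (Gamma `\ 0) (alpha k)) /\
     (fun k : nat => modulus (alpha k.+1) / modulus (alpha k)) @ \oo
       --> (0 : R)].

(* Main.v *)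
Require Import Defs.
From HB Require Import structures.
From mathcomp Require Import all_boot all_order all_algebra.
From mathcomp Require Import all_classical all_reals all_analysis.
From mathcomp Require Import complex ring lra zify.
Import Order.TTheory GRing.Theory Num.Theory.
Import numFieldNormedType.Exports.

(** The first implication rests on one construction.  On the Banach space of
complex sequences [c] with [c_i / 2^i -> 0], let [T] be the backward shift, so
that [(T^n c)_i = c_(n+i)].  Given scalars [lam k] and finite sequences [y k] of
length at most [k], write [y k / lam k] in [c] from position [j] on, for every
[j] in [A k].  The gaps between the sets [A k] keep these blocks apart, and they
place the next block, say of length [k'], at distance at least [k'].  Hence, for
[n] in [A k], [lam k *: T^n c] is [y k] up to an error tending to 0 with [k], as
soon as the entries and the [lam k] grow polynomially; if the [y k] run through
a dense set, [c] is an F_Gamma-hypercyclic vector ([shift_vector]).  The entries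
of [c] are also the zeroth coordinates of its orbit, so controlling them decides
whether [c] is hypercyclic.  Taking [lam k = 1] shows that a scalar set contains
a nonzero number.  Scalars tending to infinity leave room to keep all entries of
modulus at most 1, and scalars tending to 0 to keep them of modulus at least 1;
in both cases [c] is not hypercyclic.  So the nonzero part of an F-hypercyclic
scalar set is bounded and contains no sequence tending to 0: the set
[calC0 Gamma] is empty.

For the converse, an F_Gamma-hypercyclic vector [y] has a dense orbit once this
orbit is scaled by an annulus.  The main point is that [y] is then hypercyclic
([annulus_to_point]); compactness of the annulus bounds the delay between a
visit of the scaled orbit near [y] and a visit of the orbit itself to a given
open set, and partition regularity and right invariance conclude
([hypercyclic_vector_point]).

The annulus is removed in two steps, first its scales, then the unit circle, by
the same argument.  Let [e] be the one-parameter group of scalars to remove.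
The [t] such that [e t *: y] is a limit of the orbit, taken up to rotations in
the first step, form a closed subsemigroup of the reals with bounded gaps, which
is everything or [a Z] ([levels_dichotomy]).  In the second case each vector
[p(T) y] with [p <> 0] has a level, a real number modulo [a], depending
continuously on the vector: indeed all operators [T - mu] have dense range, so
all these vectors inherit the density property of [y].  Continuity modulo
[a] prevents a loop that contracts within these vectors from changing the level
([square_sum]).  For the circle, the loop of all rotations of [y] contracts
through [T y], but changes the level by 2 pi.  For the scales, [T] preserves
levels, so along [y], [T y], ..., [T^n y] the level changes by [n] times a fixed
amount, while the density property makes some multiple [l *: T^n y], with
[`|l|] bounded above and below, approach [r *: y] for every [r > 0]; the fixed
amount would have to be negative for large [r] and positive for small [r]. *)

Set Implicit Arguments.
Unset Strict Implicit.
Unset Printing Implicit Defensive.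

Local Open Scope classical_set_scope.
Local Open Scope ring_scope.
Local Open Scope complex_scope.

(** * Centered residues and sums around a grid *)

(** The representative of [x] modulo [a] lying in [-a/2, a/2); real numbers
known modulo [a] are compared through it. *)
Definition cres (R : realType) (a x : R) : R :=
  x - (Num.floor (x / a + 2^-1))%:~R * a.

Section CenteredResidue.
Context (R : realType) (a : R) (a_gt0 : 0 < a).
Implicit Types x y : R.

Lemma cres_bounds x : - (a / 2) <= cres a x < a / 2.
Proof.
have /andP[] := real_floor_itv (num_real (x / a + 2^-1)).
rewrite /cres; set z := Num.floor _; rewrite intrD mulr1z.
set w : R := z%:~R => h1 h2.
have : x = x / a * a by rewrite divfK// gt_eqF.
move: (x / a) h1 h2 => u h1 h2 ->.
have p1 : 0 <= (u + 2^-1 - w) * a by rewrite mulr_ge0 ?(ltW a_gt0)//; lra.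
have p2 : 0 < (w + 1 - (u + 2^-1)) * a by rewrite mulr_gt0//; lra.
by apply/andP; split; lra.
Qed.

Lemma cres_norm x : `|cres a x| <= a / 2.
Proof. by have /andP[h /ltW h'] := cres_bounds x; rewrite ler_norml h h'. Qed.

Lemma cresE x : exists z : int, cres a x = x + z%:~R * a.
Proof. by exists (- Num.floor (x / a + 2^-1)); rewrite /cres rmorphN mulNr. Qed.

Lemma int_mul_small (z : int) : `|z%:~R * a| < a -> z = 0.
Proof.
rewrite normrM (gtr0_norm a_gt0) gtr_pMl// -intr_norm -[1]/(1%:~R) ltr_int.
by case: z => [[|n]|n].
Qed.

Lemma cres_uniq x y (z : int) : `|y| < a / 2 -> x = y + z%:~R * a -> cres a x = y.
Proof.
move=> ya xE; have [w wE] := cresE x.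
have := cres_norm x => cx.
suff zw : z + w = 0 by rewrite wE xE -addrA -mulrDl -intrD zw mul0r addr0.
apply: int_mul_small; rewrite intrD mulrDl.
have -> : z%:~R * a + w%:~R * a = cres a x - y by rewrite wE xE; ring.
by apply: le_lt_trans (ler_normB _ _) _; lra.
Qed.

Lemma cres_small x : `|x| < a / 2 -> cres a x = x.
Proof. by move=> h; apply: (@cres_uniq _ _ 0) => //; rewrite mul0r addr0. Qed.

Lemma cres0 : cres a 0 = 0.
Proof. by rewrite cres_small// normr0 divr_gt0. Qed.

Lemma cresDz x (z : int) : cres a (x + z%:~R * a) = cres a x.
Proof.
rewrite /cres mulrDl mulfK ?gt_eqF// [x / a + _ + _]addrAC.
rewrite floorDrz ?intr_int// intrKfloor intrD; ring.
Qed.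

(** Two residues below [a / 4] add up without wrapping around. *)
Lemma cresD x y : `|cres a x| < a / 4 -> `|cres a y| < a / 4 ->
  cres a (x + y) = cres a x + cres a y.
Proof.
have [z zE] := cresE x; have [w wE] := cresE y => hx hy.
apply: (@cres_uniq _ _ (- (z + w))).
  by apply: le_lt_trans (ler_normD _ _) _; lra.
by rewrite zE wE mulrNz intrD; ring.
Qed.

Lemma cresN x : `|cres a x| < a / 2 -> cres a (- x) = - cres a x.
Proof.
have [z zE] := cresE x => hx.
by apply: (@cres_uniq _ _ z); rewrite ?normrN// zE; ring.
Qed.

Lemma cresB x y : `|cres a x| < a / 4 -> `|cres a y| < a / 4 ->
  cres a (x - y) = cres a x - cres a y.
Proof.
have a0 := a_gt0 => hx hy; have hy2 : `|cres a y| < a / 2 by lra.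
by rewrite cresD// cresN// normrN.
Qed.

(** A discrete Stokes formula: when neighbouring values are close modulo [a],
the increments around each cell of the grid sum to a small multiple of [a],
that is to zero, and the interior edges cancel. *)
Lemma grid_sum (N : nat) (th : nat -> nat -> R) :
  (forall i j, (i <= N)%N -> (j < N)%N -> `|cres a (th i j.+1 - th i j)| < a / 4) ->
  (forall i j, (i < N)%N -> (j <= N)%N -> `|cres a (th i.+1 j - th i j)| < a / 4) ->
  \sum_(j < N) cres a (th 0 j.+1 - th 0 j) + \sum_(i < N) cres a (th i.+1 N - th i N) =
  \sum_(i < N) cres a (th i.+1 0 - th i 0) + \sum_(j < N) cres a (th N j.+1 - th N j).
Proof.
move=> hh hv.
have cell i j : (i < N)%N -> (j < N)%N ->
    cres a (th i j.+1 - th i j) + cres a (th i.+1 j.+1 - th i j.+1) =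
    cres a (th i.+1 j - th i j) + cres a (th i.+1 j.+1 - th i.+1 j).
  move=> iN jN; rewrite -!cresD ?hh ?hv// 1?ltnW//; congr cres; ring.
have row i k : (i < N)%N -> (k <= N)%N ->
    \sum_(j < k) cres a (th i j.+1 - th i j) + cres a (th i.+1 k - th i k) =
    cres a (th i.+1 0 - th i 0) + \sum_(j < k) cres a (th i.+1 j.+1 - th i.+1 j).
  move=> iN; elim: k => [|k IH] kN; first by rewrite !big_ord0 add0r addr0.
  rewrite !big_ord_recr /= -addrA cell// addrA IH 1?ltnW//; ring.
suff tot k : (k <= N)%N ->
    \sum_(j < N) cres a (th 0 j.+1 - th 0 j) + \sum_(i < k) cres a (th i.+1 N - th i N) =
    \sum_(i < k) cres a (th i.+1 0 - th i 0) + \sum_(j < N) cres a (th k j.+1 - th k j).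
  exact: tot.
elim: k => [|k IH] kN; first by rewrite !big_ord0 add0r addr0.
by rewrite !big_ord_recr /= addrA IH 1?ltnW// -addrA row// addrA.
Qed.

End CenteredResidue.

(** * Closed subsemigroups of the real line *)

Lemma closed_approx (R : realType) (A : set R) (s : R) : closed A ->
  (forall e, 0 < e -> exists2 t, A t & `|s - t| < e) -> A s.
Proof.
move=> cA h; apply: cA => B /nbhs_ballP[e /= e0 eB].
by have [t At ts] := h e e0; exists t; split => //; apply: eB.
Qed.

Lemma near_invn_lt (R : realType) (e : R) : 0 < e ->
  \forall n \near \oo, (n%:R)^-1 < e.
Proof.
move=> e0; apply: filterS (nbhs_infty_gt (Num.truncn e^-1)) => n hn.
have h : e^-1 < n%:R by apply: lt_le_trans (truncnS_gt _) _; rewrite ler_nat.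
by rewrite -[e]invrK ltf_pV2// posrE ?invr_gt0//; apply: lt_trans h; rewrite invr_gt0.
Qed.

Section ClosedSemigroup.
Context (R : realType).
Implicit Types (S : set R) (B : R).

Lemma addclosed_muln S : S 0 -> (forall s t, S s -> S t -> S (s + t)) ->
  forall t n, S t -> S (t *+ n).
Proof.
move=> S0 SD t n St; elim: n => [|n IH]; first by rewrite mulr0n.
by rewrite mulrS; exact: SD.
Qed.

(** Arbitrarily small positive elements fill the half-line to the right of any
element, and syndeticity provides elements arbitrarily far to the left. *)
Lemma semigroup_setT S B : closed S -> S 0 ->
  (forall s t, S s -> S t -> S (s + t)) ->
  (forall s, exists2 t, S t & `|t - s| <= B) ->
  (forall e, 0 < e -> exists2 t, S t & 0 < t < e) -> forall s, S s.
Proof.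
move=> cS S0 SD Ssyn Ssmall s; apply: closed_approx => // e e0.
have [q Sq] := Ssyn (s - B); rewrite ler_norml => /andP[_ qB].
have qs : q <= s by lra.
have [p Sp /andP[p0 pe]] := Ssmall e e0.
have sqp : 0 <= (s - q) / p by rewrite divr_ge0 ?subr_ge0// ltW.
have /andP[n1 n2] := truncn_itv sqp.
set n := Num.truncn _ in n1 n2.
exists (q + p *+ n); first by apply: (SD) => //; exact: (addclosed_muln S0 SD).
rewrite ler_pdivlMr// in n1; rewrite ltr_pdivrMr// in n2.
rewrite opprD addrA -mulr_natl ger0_norm ?subr_ge0//.
by move: n2; rewrite -natr1 mulrDl mul1r; lra.
Qed.

Lemma semigroup_min S B : closed S -> S 0 ->
  (forall s t, S s -> S t -> S (s + t)) ->
  (forall s, exists2 t, S t & `|t - s| <= B) ->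
  (forall s, S s) \/ exists a : R, [/\ 0 < a, S a & forall t, S t -> 0 < t -> a <= t].
Proof.
move=> cS S0 SD Ssyn.
pose P := [set t | S t /\ 0 < t].
have P0 : P !=set0.
  have [t St] := Ssyn (B + 1); rewrite ler_norml => /andP[h _].
  by exists t; split=> //; move: h; lra.
have lbP : lbound P 0 by move=> t [_ /ltW].
have Pinf : has_inf P by split=> //; exists 0.
have [a0|a0] := leP (inf P) 0.
  left; apply: (@semigroup_setT S B) => // e e0.
  have [t [St t0] te] := inf_adherent e0 Pinf.
  by exists t => //; rewrite t0 /=; lra.
right; exists (inf P).
have Pa t : S t -> 0 < t -> inf P <= t.
  by move=> St t0; apply: ge_inf; [exists 0|].
split=> //; apply: closed_approx => // e e0.
have [t [St t0] te] := inf_adherent e0 Pinf.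
exists t => //; have := Pa t St t0 => h.
by rewrite distrC ger0_norm ?subr_ge0//; lra.
Qed.

(** Either positive or negative elements accumulate at 0, and then [S] is
everything, or there are a least positive [a] and a greatest negative [- b];
these are opposite, because [a - b] would otherwise beat one of them. *)
Lemma closed_semigroup S B : closed S -> S 0 ->
  (forall s t, S s -> S t -> S (s + t)) ->
  (forall s, exists2 t, S t & `|t - s| <= B) ->
  (forall s, S s) \/
  exists2 a : R, 0 < a & forall t, S t <-> exists z : int, t = z%:~R * a.
Proof.
move=> cS S0 SD Ssyn.
have [|[a [a0 Sa aP]]] := semigroup_min cS S0 SD Ssyn; first by left.
pose S' := [set t | S (- t)].
have cS' : closed S'.
  by apply: (@preimage_closed _ _ (@GRing.opp R)) => // x _; exact: opp_continuous.
have S'syn s : exists2 t, S' t & `|t - s| <= B.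
  have [t St ts] := Ssyn (- s); exists (- t); first by rewrite /S' /= opprK.
  by rewrite -opprD normrN -[s]opprK.
have S'0 : S' 0 by rewrite /S' /= oppr0.
have S'D s t : S' s -> S' t -> S' (s + t).
  by rewrite /S' /= => Ss St; rewrite opprD; exact: SD.
have [S'T|[b [b0 Sb bP]]] := semigroup_min cS' S'0 S'D S'syn.
  by left => s; rewrite -[s]opprK; exact: S'T.
have ab : a = b.
  have Sab : S (a - b) by exact: SD.
  have [ab|ab|//] := ltgtP a b.
    have := bP (b - a); rewrite /S' /= opprB subr_gt0 => /(_ Sab ab); lra.
  by have := aP _ Sab; rewrite subr_gt0 => /(_ ab); lra.
rewrite -{}ab in Sb.
have SZ (z : int) : S (z%:~R * a).
  case: z => n; first by rewrite -pmulrn mulr_natl; exact: (addclosed_muln S0 SD).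
  by rewrite NegzE mulrNz mulNr -mulrN -pmulrn mulr_natl; exact: (addclosed_muln S0 SD).
right; exists a => // t; split=> [St|[z ->//]].
exists (Num.floor (t / a)).
have /andP[] := real_floor_itv (num_real (t / a)).
set z := Num.floor _; rewrite intrD mulr1z ler_pdivlMr// ltr_pdivrMr// => h1 h2.
have Sr : S (t - z%:~R * a).
  by have := SZ (- z); rewrite mulrNz mulNr; exact: SD.
apply/eqP; rewrite -subr_eq0 eq_le subr_ge0 h1 andbT leNgt; apply/negP => h3.
by have := aP _ Sr h3; move: h2; rewrite mulrDl mul1r; lra.
Qed.

End ClosedSemigroup.

(** * Null-homotopic loops have zero winding *)

Section Monodromy.
Context (R : realType) (Y : topologicalType) (a : R) (a_gt0 : 0 < a).
Context (tau : Y -> R) (W : set Y).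
Hypothesis tauW : forall v, W v ->
  \forall w \near v, W w -> `|cres a (tau w - tau v)| < a / 8.

Lemma cres_local v u w : `|cres a (tau u - tau v)| < a / 8 ->
  `|cres a (tau w - tau v)| < a / 8 -> `|cres a (tau w - tau u)| < a / 4.
Proof.
have a0 := a_gt0 => hu hw.
have -> : tau w - tau u = (tau w - tau v) - (tau u - tau v) by ring.
rewrite cresB//; last 2 first.
- by lra.
- by lra.
by apply: le_lt_trans (ler_normB _ _) _; lra.
Qed.

(** Here [tau] is a real function that is continuous on [W] only modulo [a],
like an argument modulo 2 pi.  By compactness a fine grid on the square
satisfies the hypotheses of [grid_sum], so [tau] has no winding along the
boundary of the image of a square.  The sums are kept on grids, which avoids
lifting [tau] to a continuous real function. *)
Lemma square_sum (Phi : R * R -> Y) : continuous Phi ->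
  (forall s t, 0 <= s <= 1 -> 0 <= t <= 1 -> W (Phi (s, t))) ->
  \forall N \near \oo,
    \sum_(j < N) cres a (tau (Phi (0, j.+1%:R / N%:R)) - tau (Phi (0, j%:R / N%:R)))
    + \sum_(i < N) cres a (tau (Phi (i.+1%:R / N%:R, 1)) - tau (Phi (i%:R / N%:R, 1)))
    = \sum_(i < N) cres a (tau (Phi (i.+1%:R / N%:R, 0)) - tau (Phi (i%:R / N%:R, 0)))
    + \sum_(j < N) cres a (tau (Phi (1, j.+1%:R / N%:R)) - tau (Phi (1, j%:R / N%:R))).
Proof.
move=> cPhi WPhi.
pose K : set (R * R) := `[0, 1]%classic `*` `[0, 1]%classic.
have cK : compact K by apply: compact_setX; exact: segment_compact.
have KW z : K z -> W (Phi z).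
  case: z => s t [/=]; rewrite !in_itv /= => hs ht; exact: WPhi.
pose P (N : nat) (z : R * R) := K z -> forall z', K z' ->
  `|z.1 - z'.1| <= N%:R^-1 -> `|z.2 - z'.2| <= N%:R^-1 ->
  `|cres a (tau (Phi z') - tau (Phi z))| < a / 4.
have : \forall N \near \oo, K `<=` P N.
  have /compact_near_coveringP := cK; apply => z Kz.
  have /nbhs_ballP[e /= e0 eP] := cPhi z _ (tauW (KW _ Kz)).
  have e20 : 0 < e / 2 by lra.
  near=> z' N => Kz' z'' Kz'' h1 h2.
  have zz' : ball z (e / 2) z' by near: z'; exact: nbhsx_ballx.
  have Ne : N%:R^-1 < e / 2.
    by near: N; exact: near_invn_lt.
  apply: (@cres_local (Phi z)).
    by apply: eP; [apply: le_ball zz'; lra|exact: KW].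
  apply: eP; last exact: KW.
  case: zz' => h3 h4; split; rewrite /ball /= in h3 h4 *.
    by rewrite -(subrKA z'.1); apply: le_lt_trans (ler_normD _ _) _; lra.
  by rewrite -(subrKA z'.2); apply: le_lt_trans (ler_normD _ _) _; lra.
apply: filterS2 (nbhs_infty_gt 0) => N N0 KP.
have N0' : (0 : R) < N%:R by rewrite ltr0n.
have NN : N%:R / N%:R = 1 :> R by rewrite divff// gt_eqF.
have step i : `|i%:R / N%:R - i.+1%:R / N%:R| <= N%:R^-1 :> R.
  by rewrite -mulrBl -natr1 opprD addrA subrr sub0r mulN1r normrN gtr0_norm ?invr_gt0.
have Kij i j : (i <= N)%N -> (j <= N)%N -> K (i%:R / N%:R, j%:R / N%:R).
  by move=> iN jN; split; rewrite /= in_itv/= divr_ge0 ?ler0n//= ler_pdivrMr// mul1r ler_nat.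
have := @grid_sum _ a a_gt0 N (fun i j => tau (Phi (i%:R / N%:R, j%:R / N%:R))).
rewrite !mul0r !NN; apply.
- move=> i j iN jN; apply: KP.
  + by apply: Kij => //; exact: ltnW.
  + by apply: Kij => //; exact: ltnW.
  + by apply: Kij => //; exact: ltnW.
  + by rewrite /= subrr normr0 invr_ge0 ltW.
  + by rewrite /= step.
- move=> i j iN jN; apply: KP.
  + by apply: Kij => //; exact: ltnW.
  + by apply: Kij => //; exact: ltnW.
  + by apply: Kij => //; exact: ltnW.
  + by rewrite /= step.
  + by rewrite /= subrr normr0 invr_ge0 ltW.
Unshelve. all: by end_near. Qed.

End Monodromy.

(** * Complex normed spaces with a real-valued norm *)

Section RealNorm.
Context (R : realType).

Lemma normrC (z : R[i]) : `|z| = (modulus z)%:C.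
Proof. by case: z. Qed.

Lemma modulus_ge0 (z : R[i]) : 0 <= modulus z.
Proof. by case: z => a b; exact: sqrtr_ge0. Qed.

Lemma modulus_gt0 (z : R[i]) : (0 < modulus z) = (z != 0).
Proof. by rewrite -normr_gt0 normrC ltcR. Qed.

Lemma modulus_real (t : R) : modulus t%:C = `|t|.
Proof. by rewrite /real_complex_def /= expr0n /= addr0 sqrtr_sqr. Qed.

Context (X : normedModType R[i]).
Implicit Types (x y : X) (a : R[i]).

(** The norm of a normed module over [R[i]] takes complex values; estimates are
carried out on its real part, which determines it. *)
Definition nr x : R := complex.Re `|x|.

Lemma nrE x : `|x| = (nr x)%:C.
Proof. by rewrite /nr RRe_real //; apply: ger0_real; exact: normr_ge0. Qed.

Lemma nr_ge0 x : 0 <= nr x.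
Proof. by rewrite -ler0c -nrE normr_ge0. Qed.

Lemma nrZ a x : nr (a *: x) = modulus a * nr x.
Proof. by apply: (@complexI R); rewrite rmorphM /= -!nrE normrZ normrC. Qed.

Lemma nrN x : nr (- x) = nr x.
Proof. by rewrite /nr normrN. Qed.

Lemma nr_distC x y : nr (x - y) = nr (y - x).
Proof. by rewrite /nr distrC. Qed.

Lemma nrD x y : nr (x + y) <= nr x + nr y.
Proof. by rewrite -lecR rmorphD /= -!nrE ler_normD. Qed.

Lemma nrB x y : nr (x - y) <= nr x + nr y.
Proof. by rewrite -[nr y]nrN nrD. Qed.

Lemma nr_dist x y z : nr (x - z) <= nr (x - y) + nr (y - z).
Proof. by rewrite -(subrKA y) nrD. Qed.

Lemma nr_eq0 x : nr x = 0 -> x = 0.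
Proof. by move=> h; apply/eqP; rewrite -normr_eq0 nrE h. Qed.

Lemma ball_nr x y (e : R) : ball x e%:C y <-> nr (x - y) < e.
Proof. by rewrite -ball_normE /ball_ /= nrE ltcR. Qed.

Lemma nbhs_nrP x (B : set X) :
  nbhs x B <-> exists2 e : R, 0 < e & forall y, nr (x - y) < e -> B y.
Proof.
split=> [/nbhs_ballP[e /= e0 eB]|[e e0 eB]].
  have eE : e = (complex.Re e)%:C by rewrite RRe_real// gtr0_real.
  exists (complex.Re e); first by rewrite -ltcR -eE.
  by move=> y; rewrite -ball_nr -eE; exact: eB.
apply/nbhs_ballP; exists e%:C; first by rewrite /= ltcR.
by move=> y; rewrite ball_nr; exact: eB.
Qed.

Lemma closure_nrP (A : set X) x :
  closure A x <-> forall e : R, 0 < e -> exists2 y, A y & nr (x - y) < e.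
Proof.
split=> [cA e e0|h B /nbhs_nrP[e e0 eB]].
  have [|y [Ay ye]] := cA [set y | nr (x - y) < e]; last by exists y.
  by apply/nbhs_nrP; exists e.
by have [y Ay /eB By] := h e e0; exists y.
Qed.

End RealNorm.

Section Operators.
Context (R : realType) (X : normedModType R[i]) (T : {linear X -> X}).
Implicit Types (x y : X) (a : R[i]).

Lemma iter_linearZ n a x : iter n T (a *: x) = a *: iter n T x.
Proof. by elim: n => //= n ->; rewrite linearZ. Qed.

Lemma iter_linearD n x y : iter n T (x + y) = iter n T x + iter n T y.
Proof. by elim: n => //= n ->; rewrite linearD. Qed.

Lemma iter_linearB n x y : iter n T (x - y) = iter n T x - iter n T y.
Proof. by elim: n => //= n ->; rewrite linearB. Qed.

Lemma bounded_operator_nr : bounded_operator T ->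
  exists2 M : R, 0 < M & forall x, nr (T x) <= M * nr x.
Proof.
move=> [M hM]; exists (`|M| + 1) => [|x]; first by rewrite ltr_wpDl.
have := hM x; rewrite !nrE -rmorphM lecR => h; apply: le_trans h _.
by rewrite ler_wpM2r ?nr_ge0// ler_wpDr// ler_norm.
Qed.

Lemma bounded_operator_continuous : bounded_operator T -> continuous T.
Proof.
move=> /bounded_operator_nr[M M0 TM] x B /nbhs_nrP[e e0 eB].
apply/nbhs_nrP; exists (e / M); first exact: divr_gt0.
move=> y xy; apply: eB; rewrite -linearB; apply: le_lt_trans (TM _) _.
by rewrite mulrC -ltr_pdivlMr.
Qed.

Lemma iter_continuous : continuous T -> forall n, continuous (iter n T).
Proof.
move=> cT; elim=> [|n IH] x /=; first exact: cvg_id.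
by apply: (@continuous_comp _ _ _ (iter n T) T); [exact: IH|exact: cT].
Qed.

Lemma scale_iter_continuous : continuous T ->
  forall n a, continuous (fun x => a *: iter n T x).
Proof.
move=> cT n a x; apply: (@continuous_comp _ _ _ (iter n T) ( *:%R a)).
  exact: iter_continuous.
exact: scaler_continuous.
Qed.

Definition orb (Om : set R[i]) (x : X) : set X :=
  [set w | exists a n, Om a /\ w = a *: iter n T x].

Definition reach (Om : set R[i]) (x : X) : set X := closure (orb Om x).

(** For [Om] the point 1 this is hypercyclicity of [x]. *)
Definition cyclic_for (Om : set R[i]) x := forall y, reach Om x y.

(** * Dense range of T - mu and polynomials in T *)

Section DenseRange.
Context (K : set R[i]) (m M : R) (m_gt0 : 0 < m).
Hypothesis Kbd : forall a, K a -> m <= modulus a <= M.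
Context (mu : R[i]).

Let far v (r : R) := forall w, r <= nr (v - (T w - mu *: w)).

Let far_shift v u r : far v r -> far (v + (T u - mu *: u)) r.
Proof.
move=> h w; have := h (w - u); rewrite (linearB T) scalerBr.
have -> : T w - T u - (mu *: w - mu *: u) = T w - mu *: w - (T u - mu *: u).
  by rewrite !opprD !opprK addrACA.
by rewrite opprB addrA.
Qed.

Lemma iter_mod_range n x : exists w, iter n T x = mu ^+ n *: x + (T w - mu *: w).
Proof.
elim: n => [|n [w IH]]; first by exists 0; rewrite linear0 scaler0 subrr addr0 expr0 scale1r.
exists (iter n T x + mu *: w) => /=.
rewrite (linearD T) [T (mu *: w)]linearZ (scalerDr mu) opprD addrACA /=.
have -> : mu *: T w - mu *: (mu *: w) = mu *: iter n T x - mu ^+ n.+1 *: x.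
  by rewrite IH scalerDr [_ *: (mu ^+ n *: x)]scalerA -exprS scalerBr addrAC subrr add0r.
by rewrite subrKA addrC subrK.
Qed.

(** The distance to the range of [T - mu] is multiplied by [`|mu|] under [T].
If it were not identically zero, then along the orbit of [x], scaled by
numbers of modulus in [[m, M]], it would be comparable to [`|mu| ^ n]; so it
would miss large values when [`|mu| <= 1] and small ones when [1 < `|mu|],
which contradicts density.  [far v r] says that this distance is at least
[r]. *)
Lemma dense_range x : cyclic_for K x ->
  forall v, closure [set T w - mu *: w | w in setT] v.
Proof.
move=> cx v; apply/closure_nrP => r r0; apply: contrapT => vr'.
have vr : far v r.
  move=> w; rewrite leNgt; apply/negP => we.
  by apply: vr'; exists (T w - mu *: w) => //; exists w.
have far0 u s : far u s -> s <= nr u.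
  by move=> /(_ 0); rewrite linear0 scaler0 subrr subr0.
have farZ a u s : a != 0 -> far u s -> far (a *: u) (modulus a * s).
  move=> a0 h w; rewrite (_ : a *: u - _ = a *: (u - (T (a^-1 *: w) - mu *: (a^-1 *: w)))).
    by rewrite nrZ ler_wpM2l ?modulus_ge0.
  rewrite scalerBr; congr (_ - _).
  by rewrite scalerBr [T (_ *: w)]linearZ /= !scalerA mulrAC divff// mul1r scale1r.
have far_near u u' s d : nr (u - u') < d -> far u s -> far u' (s - d).
  move=> uu' h w; have := h w; have := nr_dist u u' (T w - mu *: w); lra.
have far_iter n s a : far (a *: iter n T x) s -> far ((a * mu ^+ n) *: x) s.
  have [w ->] := iter_mod_range n x => /(far_shift (- (a *: w))).
  rewrite [T (- _)]linearN [T (a *: w)]linearZ /= scalerN -opprD scalerDr scalerBr.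
  by rewrite !scalerA [mu * a]mulrC addrK.
have K0 a : K a -> a != 0.
  by move=> /Kbd/andP[h _]; rewrite -modulus_gt0; apply: lt_le_trans h.
have muN n : modulus (mu ^+ n) = modulus mu ^+ n.
  elim: n => [|n IH]; first by rewrite !expr0 ComplexField.Normc.normc1.
  by rewrite !exprS ComplexField.Normc.normcM IH.
have [mu1|mu1] := leP (modulus mu) 1.
  (* [L *: v] is at distance at least [M * nr x + 2] from the range, too far to
     be within 1 of the scaled orbit. *)
  pose L : R := (M * nr x + 2) / r.
  have x0 := nr_ge0 x.
  have M0 : 0 <= M.
    have /closure_nrP/(_ 1 ltr01)[_ [a [n [/Kbd/andP[h1 h2] _]]] _] := cx 0.
    by move: m_gt0; lra.
  have L0 : 0 < L by rewrite divr_gt0// ltr_wpDl// mulr_ge0.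
  have /closure_nrP/(_ 1 ltr01)[_ [a [n [Ka ->]]] d1] := cx (L%:C *: v).
  have L0' : L%:C != 0 by rewrite -modulus_gt0 modulus_real normr_gt0 gt_eqF.
  have := far_near _ _ _ _ d1 (farZ _ _ _ L0' vr).
  rewrite modulus_real gtr0_norm// divfK ?gt_eqF//.
  move=> /far_iter/far0; rewrite nrZ ComplexField.Normc.normcM muN.
  have /andP[_ aM] := Kbd Ka.
  have : modulus a * modulus mu ^+ n * nr x <= M * nr x.
    rewrite ler_wpM2r// -[M]mulr1 ler_pM ?modulus_ge0 ?exprn_ge0 ?modulus_ge0//.
    by rewrite exprn_ile1 ?modulus_ge0.
  lra.
(* First the distance from [x] itself to the range is positive. *)
have [s s0 xs] : exists2 s : R, 0 < s & far x s.
  have r20 : 0 < r / 2 by rewrite divr_gt0.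
  have /closure_nrP/(_ _ r20)[_ [a [n [Ka ->]]] d1] := cx v.
  have amu0 : a * mu ^+ n != 0.
    rewrite mulf_neq0 ?(K0 _ Ka)// expf_neq0// -modulus_gt0.
    exact: lt_trans mu1.
  have /(farZ (a * mu ^+ n)^-1) := far_iter _ _ _ (far_near _ _ _ _ d1 vr).
  rewrite scalerA mulVf// scale1r invr_eq0 => /(_ amu0) h.
  exists (modulus (a * mu ^+ n)^-1 * (r - r / 2)) => //.
  by rewrite mulr_gt0 ?modulus_gt0 ?invr_eq0//; lra.
have ms0 : 0 < m * s by rewrite mulr_gt0.
have /closure_nrP/(_ _ ms0)[_ [a [n [Ka ->]]]] := cx 0.
rewrite sub0r nrN => d1; suff : m * s <= nr (a *: iter n T x) by rewrite leNgt d1.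
have [w Ew] := iter_mod_range n x.
have amu0 : a * mu ^+ n != 0.
  rewrite mulf_neq0 ?(K0 _ Ka)// expf_neq0// -modulus_gt0.
  exact: lt_trans mu1.
have := far0 _ _ (far_shift (a *: w) (farZ _ _ _ amu0 xs)).
rewrite [T (a *: w)]linearZ /= Ew scalerDr !scalerBr !scalerA [mu * a]mulrC.
apply: le_trans; rewrite ComplexField.Normc.normcM muN ler_wpM2r ?(ltW s0)//.
have /andP[am _] := Kbd Ka; rewrite -[m]mulr1 ler_pM ?(ltW m_gt0)//.
by rewrite exprn_ege1// ltW.
Qed.

End DenseRange.
End Operators.
Section PolynomialOrbits.
Context (R : realType) (X : normedModType R[i]) (T : {linear X -> X}).
Context (cT : continuous T) (K : set R[i]) (m M : R) (m_gt0 : 0 < m).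
Hypothesis Kbd : forall a, K a -> m <= modulus a <= M.
Implicit Types (x y : X) (p q : {poly R[i]}).

Lemma cyclic_scale c x : c != 0 -> cyclic_for T K x -> cyclic_for T K (c *: x).
Proof.
move=> c0 cx y B; rewrite -{1}[y](scale1r) -(divff c0) -scalerA => /scaler_continuous.
move=> /(cx _)[_ [[a [n [Ka ->]]] Bz]].
exists (c *: (a *: iter n T x)); split=> //; exists a, n; split=> //.
by rewrite iter_linearZ !scalerA mulrC.
Qed.

Lemma cyclic_subr mu x : cyclic_for T K x -> cyclic_for T K (T x - mu *: x).
Proof.
move=> cx y B; rewrite nbhsE => -[V [oV Vy] VB].
have [|_ [[w _ <-] Vw]] := dense_range m_gt0 Kbd mu cx (v := y) (B := V).
  exact: open_nbhs_nbhs.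
have cS : continuous (fun w => T w - mu *: w).
  move=> u; apply: cvgB; first exact: cT.
  exact: scaler_continuous.
have [|_ [[a [n [Ka ->]]] Vz]] := cx w ((fun w => T w - mu *: w) @^-1` V).
  by apply: cS; exact: open_nbhs_nbhs.
exists (T (a *: iter n T x) - mu *: (a *: iter n T x)); split; last exact: VB.
exists a, n; split=> //; rewrite iter_linearB iter_linearZ scalerBr linearZ /=.
by rewrite !scalerA [mu * a]mulrC -iterSr iterS.
Qed.

Definition papply p x : X := \sum_(i < size p) p`_i *: iter i T x.

Lemma papply_wide n p x : (size p <= n)%N ->
  papply p x = \sum_(i < n) p`_i *: iter i T x.
Proof.
move=> pn; rewrite /papply (big_ord_widen n (fun i => p`_i *: iter i T x))//.
rewrite big_mkcond; apply: eq_bigr => i _; case: ltnP => // h.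
by rewrite nth_default// scale0r.
Qed.

Lemma papplyD p q x : papply (p + q) x = papply p x + papply q x.
Proof.
pose n := maxn (size p) (size q).
rewrite (@papply_wide n (p + q)) ?size_polyD// (@papply_wide n p) ?leq_maxl//.
rewrite (@papply_wide n q) ?leq_maxr//.
by rewrite -big_split /=; apply: eq_bigr => i _; rewrite coefD scalerDl.
Qed.

Lemma papplyZ c p x : papply (c *: p) x = c *: papply p x.
Proof.
rewrite (@papply_wide (size p) (c *: p)) ?size_scale_leq//.
by rewrite scaler_sumr; apply: eq_bigr => i _; rewrite coefZ scalerA.
Qed.

Lemma papplyXn n x : papply 'X^n x = iter n T x.
Proof.
rewrite /papply size_polyXn big_ord_recr /= coefXn eqxx scale1r big1 ?add0r// => i _.
by rewrite coefXn ltn_eqF// scale0r.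
Qed.

Lemma papply1 x : papply 1 x = x.
Proof. by rewrite -[1](expr0 'X) papplyXn. Qed.

Lemma papplyXM q x : papply ('X * q) x = T (papply q x).
Proof.
rewrite (@papply_wide (size q).+1); last first.
  by apply: leq_trans (size_polyMleq _ _) _; rewrite size_polyX.
rewrite big_ord_recl coefXM eqxx scale0r add0r raddf_sum.
by apply: eq_bigr => i _; rewrite coefXM /= linearZ.
Qed.

(** Over the complex numbers [p(T)] is a product of operators [T - mu], each of
which preserves cyclicity because its range is dense. *)
Lemma papply_cyclic p x : p != 0 -> cyclic_for T K x -> cyclic_for T K (papply p x).
Proof.
move=> p0 cx; have [r ->] := closed_field_poly_normal p.
rewrite papplyZ; apply: cyclic_scale; first by rewrite lead_coef_eq0.
elim: r => [|z r IH]; first by rewrite big_nil papply1.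
rewrite big_cons mulrBl papplyD papplyXM -mulNr -polyCN mul_polyC papplyZ.
by rewrite scaleNr; exact: cyclic_subr.
Qed.

End PolynomialOrbits.

(** * Levels of a vector along a one-parameter group of scalars *)

Section PhaseLevels.
Context (R : realType) (X : normedModType R[i]) (T : {linear X -> X}).
Context (cT : continuous T).
Context (Om : set R[i]) (e : R -> R[i]) (B : R).
Hypothesis Om1 : Om 1.
Hypothesis OmM : forall a b, Om a -> Om b -> Om (a * b).
Hypothesis e0 : e 0 = 1.
Hypothesis eD : forall s t, e (s + t) = e s * e t.
Hypothesis ce : continuous (e : R -> R[i]^o).
Implicit Types (u v w : X) (s t : R).

(** [e] is a one-parameter group of scalars and [Om] a multiplicative set.  Two
cases are used: the real exponential with [Om] the unit circle, where
[phase_set] is an annulus, and [t |-> exp (i t)] with [Om = [set 1]], where it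
is the unit circle. *)
Definition phase_set : set R[i] := [set a | exists t b, [/\ `|t| <= B, Om b & a = e t * b]].

(** The set of [t] such that [e t *: v] is a limit of the [Om]-orbit of [u].
When [e] is a real exponential it records at which scales, and when [e] is a
rotation at which angles, [v] is approached. *)
Definition levels u v : set R := [set t | reach T Om u (e t *: v)].

Lemma reach_refl u : reach T Om u u.
Proof.
by apply: subset_closure; exists 1, 0%N; split=> //; rewrite scale1r.
Qed.

Lemma reach_iter a u v : Om a -> reach T Om u v -> forall n, reach T Om u (a *: iter n T v).
Proof.
move=> Oa uv n C /(scale_iter_continuous cT) /uv[_ [[b [k [Ob ->]]] Cz]].
exists (a *: iter n T (b *: iter k T u)); split=> //.
exists (a * b), (n + k)%N; split; first exact: OmM.
by rewrite iter_linearZ scalerA iterD.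
Qed.

Lemma reach_trans u v w : reach T Om u v -> reach T Om v w -> reach T Om u w.
Proof.
move=> uv vw; apply: closed_closure.
apply: closure_subset vw => _ [a [n [Oa ->]]]; exact: reach_iter.
Qed.

Lemma reachZ c u v : reach T Om u v -> reach T Om (c *: u) (c *: v).
Proof.
move=> uv C /scaler_continuous /uv[_ [[b [k [Ob ->]]] Cz]].
exists (c *: (b *: iter k T u)); split=> //; exists b, k; split=> //.
by rewrite iter_linearZ !scalerA mulrC.
Qed.

Lemma levels_add u v w s t : levels u v s -> levels v w t -> levels u w (s + t).
Proof.
move=> us vt; apply: reach_trans us _.
by rewrite eD -scalerA; exact: reachZ.
Qed.

Lemma levels_scale a u v s t : Om a -> levels u v t -> levels u ((e s * a) *: v) (t - s).
Proof.
move=> Oa uv; rewrite /levels /= scalerA mulrA -eD subrK mulrC -scalerA.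
exact: (reach_iter (n := 0) Oa (uv : reach T Om u (e t *: v))).
Qed.

Lemma levels_iter u v t : levels u v t -> levels u (T v) t.
Proof.
move=> uv; have := reach_iter (n := 1) Om1 (uv : reach T Om u (e t *: v)).
by rewrite scale1r /= linearZ; exact.
Qed.

Lemma phase_action_continuous : continuous (fun z : R * X => e z.1 *: z.2).
Proof.
move=> z; apply: cvgZ; last exact: cvg_snd.
by apply: (@continuous_comp _ _ (R[i]^o) (@fst R X) e); [exact: cvg_fst|exact: ce].
Qed.

Lemma closed_levels u v : closed (levels u v).
Proof.
apply: (@preimage_closed _ _ (fun t => e t *: v)); last exact: closed_closure.
move=> t _; apply: cvgZ; [exact: ce|exact: cvg_cst].
Qed.

(** The orbit scaled by [phase_set] comes near [e s *: v]; compactness of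
[[-B, B]] turns the phases used into a limit phase. *)
Lemma levels_syndetic u v s : cyclic_for T phase_set u ->
  exists2 t, levels u v t & `|t - s| <= B.
Proof.
move=> cu.
suff [t [ht tB]] : exists t, reach T Om u (e t *: (e s *: v)) /\ `|t| <= B.
  by exists (t + s); rewrite ?addrK// /levels /= eD -scalerA.
move: (e s *: v) => {s} {}v; apply: contrapT => /forallNP h.
have Vcov : \forall w \near v, `[- B, B] `<=` (fun t => ~ reach T Om u (e t *: w)).
  have /compact_near_coveringP := @segment_compact R (- B) B; apply => t.
  rewrite /= in_itv /= -ler_norml => tB.
  have nt : ~ reach T Om u (e t *: v) by move=> ht; exact: (h t).
  have : \forall z \near (t, v), ~ reach T Om u (e z.1 *: z.2).
    have cpa := phase_action_continuous; apply: (cpa (t, v) (~` reach T Om u)).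
    apply: open_nbhs_nbhs; split=> //.
    exact/closed_openC/closed_closure.
  by apply: filterS => -[].
have [_ [[_ [n [[t [b [tB Ob ->]]] ->]]] /= /(_ (- t))]] := cu v _ Vcov.
rewrite /= in_itv /= -ler_norml normrN => /(_ tB); apply.
rewrite !scalerA mulrA -eD addNr e0 mul1r.
by apply: subset_closure; exists b, n.
Qed.

(** The levels of [u] relative to itself form a closed semigroup with bounded
gaps.  If it is the whole line, phases can be removed altogether. *)
Lemma levels_dichotomy u : cyclic_for T phase_set u ->
  cyclic_for T Om u \/
  exists2 a : R, 0 < a & forall t, levels u u t <-> exists z : int, t = z%:~R * a.
Proof.
move=> cu; have [||||full|] := @closed_semigroup _ (levels u u) B.
- exact: closed_levels.
- by rewrite /levels /= e0 scale1r; exact: reach_refl.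
- by move=> s t; exact: levels_add.
- by move=> s; exact: levels_syndetic.
- left=> v; have [t ut _] := levels_syndetic v 0 cu.
  have := levels_add (full (- t)) ut.
  by rewrite addNr /levels /= e0 scale1r.
- by right.
Qed.

Section Discrete.
Context (x : X) (cx : cyclic_for T phase_set x) (a : R) (a_gt0 : 0 < a).
Hypothesis xa : forall t, levels x x t <-> exists z : int, t = z%:~R * a.

(** Adding a level of [x] relative to [v] sends both numbers to levels of [x]
relative to itself. *)
Lemma levels_cong v s t : cyclic_for T phase_set v ->
  levels x v s -> levels x v t -> exists z : int, s = t + z%:~R * a.
Proof.
move=> cv hs ht; have [r vr _] := levels_syndetic x 0 cv.
have /xa[z zE] := levels_add hs vr; have /xa[w wE] := levels_add ht vr.
exists (z - w); rewrite intrB mulrBl -zE -wE; ring.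
Qed.

(** An arbitrary choice of a level; it is well defined modulo [a], and only its
residues are used. *)
Definition level v : R := xget 0 (levels x v).

Lemma levelP v : levels x v (level v).
Proof.
rewrite /level; have [t xt _] := levels_syndetic v 0 cx.
by apply: xgetPex; exists t.
Qed.

Lemma level_cong v t : cyclic_for T phase_set v -> levels x v t ->
  exists z : int, level v = t + z%:~R * a.
Proof. by move=> cv; apply: levels_cong => //; exact: levelP. Qed.

(** Phases in [[-B, B]] that are far from [level v] modulo [a] send [v] outside
the closed set [reach x]; by compactness they still do so for [w] near
[v]. *)
Lemma level_continuous v : cyclic_for T phase_set v ->
  \forall w \near v, cyclic_for T phase_set w -> `|cres a (level w - level v)| < a / 8.
Proof.
move=> cv.
have : \forall w \near v, `[- B, B] `<=` (fun t => levels x w t -> `|cres a (t - level v)| < a / 8).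
  have /compact_near_coveringP := @segment_compact R (- B) B; apply => t.
  move=> _; have [xt|nt] := pselect (levels x v t).
    have [z zE] := level_cong cv xt.
    have ha : 0 < a / 8 by rewrite divr_gt0.
    near=> t' w => _.
    have tt' : `|t - t'| < a / 8 by near: t'; exact: nbhsx_ballx.
    rewrite (@cres_uniq _ _ a_gt0 _ (t' - t) (- z)).
    + by rewrite distrC.
    + by rewrite distrC; apply: lt_trans tt' _; have := a_gt0; lra.
    + by rewrite zE mulrNz /=; ring.
  have : \forall z \near (t, v), ~ reach T Om x (e z.1 *: z.2).
    have cpa := phase_action_continuous; apply: (cpa (t, v) (~` reach T Om x)).
    apply: open_nbhs_nbhs; split=> //.
    exact/closed_openC/closed_closure.
  by apply: filterS => -[].
apply: filterS => w cov cw.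
have [t xt tB] := levels_syndetic w 0 cx; rewrite subr0 in tB.
have [z zE] := level_cong cw xt.
rewrite zE addrAC cresDz//; apply: cov => //.
by rewrite /= in_itv /= -ler_norml.
Unshelve. all: by end_near. Qed.

End Discrete.
End PhaseLevels.

(** * From the unit circle to a single scalar *)

Lemma modulus_le (R : realType) (z : R[i]) : modulus z <= `|complex.Re z| + `|complex.Im z|.
Proof.
case: z => u v /=; rewrite -[leRHS]ger0_norm ?addr_ge0// -sqrtr_sqr ler_wsqrtr//.
rewrite sqrrD !real_normK ?num_real// lerD2r lerDl.
by rewrite mulrn_wge0// mulr_ge0.
Qed.

Lemma nr_regular (R : realType) (z : R[i]^o) : nr z = modulus z.
Proof. by apply: (@complexI R); rewrite -nrE normrC. Qed.

Lemma complex_continuous (R : realType) (U : topologicalType) (g h : U -> R) :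
  continuous g -> continuous h -> continuous (fun u => (g u +i* h u : R[i]^o)).
Proof.
move=> cg ch u B /nbhs_nrP[e e0 eB].
have e20 : 0 < e / 2 by rewrite divr_gt0.
have gu : \forall w \near u, `|g u - g w| < e / 2.
  by apply: (cg u [set y | `|g u - y| < e / 2]); exact: nbhsx_ballx.
have hu : \forall w \near u, `|h u - h w| < e / 2.
  by apply: (ch u [set y | `|h u - y| < e / 2]); exact: nbhsx_ballx.
apply: filterS2 gu hu => w gw hw; apply: eB; rewrite nr_regular.
apply: le_lt_trans (modulus_le _) _.
by rewrite /=; lra.
Qed.

Lemma real_complex_continuous (R : realType) (U : topologicalType) (g : U -> R) :
  continuous g -> continuous (fun u => ((g u)%:C : R[i]^o)).
Proof. by move=> cg; apply: complex_continuous => // u; exact: cvg_cst. Qed.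

Lemma scale1DX_eq0 (F : fieldType) (c d : F) :
  c *: 1 + d *: 'X = 0 :> {poly F} -> c = 0 /\ d = 0.
Proof.
move=> p0; have := congr1 (fun q : {poly F} => q`_1) p0.
have := congr1 (fun q : {poly F} => q`_0) p0.
by rewrite !coefD !coefZ !coefX !coef1 !coef0 /= !mulr1 !mulr0 add0r addr0.
Qed.

Section LevelDifferences.
Context (R : realType) (X : normedModType R[i]) (T : {linear X -> X}).
Context (cT : continuous T).
Context (Om : set R[i]) (e : R -> R[i]) (B : R).
Hypothesis Om1 : Om 1.
Hypothesis OmM : forall a b, Om a -> Om b -> Om (a * b).
Hypothesis e0 : e 0 = 1.
Hypothesis eD : forall s t, e (s + t) = e s * e t.
Hypothesis ce : continuous (e : R -> R[i]^o).
Context (x : X).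
Local Notation W := (cyclic_for T (phase_set Om e B)).
Hypothesis cx : W x.
Context (a : R) (a_gt0 : 0 < a).
Hypothesis xa : forall t, levels T Om e x x t <-> exists z : int, t = z%:~R * a.
Local Notation level := (level T Om e x).
Implicit Types (v w : X).

Lemma level_shift_phase v s b : Om b -> W ((e s * b) *: v) ->
  exists z : int, level ((e s * b) *: v) = level v - s + z%:~R * a.
Proof.
move=> Ob Wv; apply: (level_cong cT OmM e0 eD ce cx xa Wv).
apply: levels_scale => //; exact: (levelP e0 eD ce cx).
Qed.

Lemma level_diff_phase v s b s' b' : Om b -> Om b' ->
  W ((e s * b) *: v) -> W ((e s' * b') *: v) ->
  cres a (level ((e s' * b') *: v) - level ((e s * b) *: v)) = cres a (s - s').
Proof.
move=> Ob Ob' h h'.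
have [z ->] := level_shift_phase Ob h; have [z' ->] := level_shift_phase Ob' h'.
rewrite -(cresDz a_gt0 (s - s') (z' - z)); congr cres; rewrite intrB; ring.
Qed.

Lemma level_diff_scale v w s b : Om b ->
  W ((e s * b) *: v) -> W ((e s * b) *: w) ->
  cres a (level ((e s * b) *: w) - level ((e s * b) *: v)) = cres a (level w - level v).
Proof.
move=> Ob h h'.
have [z ->] := level_shift_phase Ob h; have [z' ->] := level_shift_phase Ob h'.
rewrite -(cresDz a_gt0 (level w - level v) (z' - z)); congr cres; rewrite intrB; ring.
Qed.

Lemma level_diff_iter n v w : W v -> W w -> (forall k, W (iter k T v)) ->
  (forall k, W (iter k T w)) ->
  cres a (level (iter n T w) - level (iter n T v)) = cres a (level w - level v).
Proof.
move=> hv hw hv' hw'; elim: n => //= n <-.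
have step u : W (iter n.+1 T u) -> exists z : int,
    level (T (iter n T u)) = level (iter n T u) + z%:~R * a.
  move=> hu; apply: (level_cong cT OmM e0 eD ce cx xa hu).
  apply: levels_iter => //; exact: (levelP e0 eD ce cx).
have [z ->] := step _ (hv' n.+1); have [z' ->] := step _ (hw' n.+1).
rewrite -(cresDz a_gt0 (level (iter n T w) - level (iter n T v)) (z' - z)).
by congr cres; rewrite intrB; ring.
Qed.

Lemma level_square (Phi : R * R -> X) : continuous Phi ->
  (forall s t, 0 <= s <= 1 -> 0 <= t <= 1 -> W (Phi (s, t))) ->
  \forall N \near \oo,
    \sum_(j < N) cres a (level (Phi (0, j.+1%:R / N%:R)) - level (Phi (0, j%:R / N%:R)))
    + \sum_(i < N) cres a (level (Phi (i.+1%:R / N%:R, 1)) - level (Phi (i%:R / N%:R, 1)))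
    = \sum_(i < N) cres a (level (Phi (i.+1%:R / N%:R, 0)) - level (Phi (i%:R / N%:R, 0)))
    + \sum_(j < N) cres a (level (Phi (1, j.+1%:R / N%:R)) - level (Phi (1, j%:R / N%:R))).
Proof.
apply: square_sum => // v Wv.
exact: (level_continuous cT OmM e0 eD ce cx a_gt0 xa Wv).
Qed.

End LevelDifferences.

Section CircleToPoint.
Context (R : realType) (X : normedModType R[i]) (T : {linear X -> X}).
Context (cT : continuous T).

Definition unit_circle : set R[i] := [set z | modulus z = 1].

Definition cis (t : R) : R[i] := cos t +i* sin t.

Lemma cis0 : cis 0 = 1.
Proof. by rewrite /cis cos0 sin0. Qed.

Lemma cisD s t : cis (s + t) = cis s * cis t.
Proof. by rewrite /cis cosD sinD; apply/eqP; rewrite eq_complex /= eqxx addrC eqxx. Qed.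

Lemma modulus_cis t : modulus (cis t) = 1.
Proof. by rewrite /= cos2Dsin2 sqrtr1. Qed.

Lemma cis_continuous : continuous (cis : R -> R[i]^o).
Proof. by apply: complex_continuous; [exact: continuous_cos|exact: continuous_sin]. Qed.

Lemma cis_surj z : unit_circle z -> exists2 t, `|t| <= pi & z = cis t.
Proof.
case: z => u v; rewrite /unit_circle /= => h.
have h2 : u ^+ 2 + v ^+ 2 = 1.
  by rewrite -[LHS]sqr_sqrtr ?addr_ge0 ?sqr_ge0// h expr1n.
have u1 : -1 <= u <= 1.
  rewrite -ler_norml -(@ler_pXn2r _ 2)// ?nnegrE// real_normK ?num_real// expr1n.
  by rewrite -h2 lerDl sqr_ge0.
have sv : Num.sqrt (1 - u ^+ 2) = `|v| by rewrite -h2 addrAC subrr add0r sqrtr_sqr.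
have acu : `|acos u| <= pi.
  by rewrite ger0_norm ?acos_ge0// acos_lepi.
have [v0|v0] := leP 0 v.
  by exists (acos u) => //; rewrite /cis acosK ?in_itv// sin_acos// sv ger0_norm.
exists (- acos u); first by rewrite normrN.
by rewrite /cis cosN sinN acosK ?in_itv// sin_acos// sv ltr0_norm// opprK.
Qed.

Lemma cyclic_for_sub (K K' : set R[i]) x : K `<=` K' -> cyclic_for T K x -> cyclic_for T K' x.
Proof.
move=> KK' cx y; apply: closure_subset (cx y) => _ [a [n [Ka ->]]].
by exists a, n; split=> //; exact: KK'.
Qed.

(** If angles were only determined up to a discrete group, the level would be
continuous modulo [a] on the vectors [p(T) x] with [p <> 0].  But among these
[(1 - s) exp (2 pi i t) x + s T x] contracts the loop [exp (2 pi i t) x], along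
which the level decreases by 2 pi. *)
Lemma circle_to_point x : cyclic_for T unit_circle x -> cyclic_for T [set 1] x.
Proof.
move=> cx0; pose e := cis; pose Om : set R[i] := [set 1].
have Om1 : Om 1 by [].
have OmM a b : Om a -> Om b -> Om (a * b) by move=> -> ->; rewrite /Om /= mulr1.
have ce : continuous (e : R -> R[i]^o) := cis_continuous.
pose K := phase_set Om e pi.
have cx : cyclic_for T K x.
  apply: cyclic_for_sub cx0 => z /cis_surj[t tpi ->].
  by exists t, 1; rewrite mulr1.
have Kbd z : K z -> 1 <= modulus z <= 1.
  by move=> [t [_ [_ -> ->]]]; rewrite mulr1 modulus_cis lexx.
have [//|[a a0 xa]] := levels_dichotomy cT Om1 OmM cis0 cisD ce cx.
exfalso.
pose Phi (z : R * R) : X := (((1 - z.1)%:C * cis (2 * pi * z.2)) *: x + z.1%:C *: T x).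
have cPhi : continuous Phi.
  move=> z; apply: cvgD.
    apply: cvgZ; last exact: cvg_cst.
    apply: (@cvgM R[i] (R * R)%type).
      apply: (@real_complex_continuous _ _ (fun z : R * R => 1 - z.1)) => w.
      by apply: cvgB; [exact: cvg_cst|exact: cvg_fst].
    apply: (@continuous_comp _ _ (R[i]^o) (fun z : R * R => 2 * pi * z.2) cis).
      by apply: cvgMr; exact: cvg_snd.
    exact: cis_continuous.
  apply: cvgZ; last exact: cvg_cst.
  apply: (@real_complex_continuous _ _ (fun z : R * R => z.1)) => w.
  exact: cvg_fst.
have WPhi s t : 0 <= s <= 1 -> 0 <= t <= 1 -> cyclic_for T K (Phi (s, t)).
  move=> _ _; pose p : {poly R[i]} := ((1 - s)%:C * cis (2 * pi * t)) *: 1 + s%:C *: 'X.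
  have -> : Phi (s, t) = papply T p x.
    by rewrite papplyD !papplyZ papply1 -['X]expr1 papplyXn.
  apply: (papply_cyclic cT ltr01 Kbd) => //.
  apply/eqP => /scale1DX_eq0[h1 h2].
  have s0 : s = 0 by case: h2.
  move: h1; rewrite s0 subr0 mul1r => h1.
  have := modulus_cis (2 * pi * t); rewrite h1 ComplexField.Normc.normc0.
  by move=> /esym/eqP; rewrite oner_eq0.
have pa : 0 < a / 2 / (2 * pi) by rewrite !divr_gt0// mulr_gt0// pi_gt0.
have [N [[N1 Npa]]] := filter_ex (filterI (filterI (nbhs_infty_gt 0) (near_invn_lt pa))
  (level_square cT OmM cis0 cisD ce cx a0 xa cPhi WPhi)).
have N0 : 0 < N%:R :> R by rewrite ltr0n.
have Phi10 (s : R) : Phi (s, 1) = Phi (s, 0).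
  by rewrite /Phi /= mulr1 mulr0 cis0 [cis _]/cis [2 * pi]mulr_natl cos2pi sin2pi.
rewrite [RHS]addrC; under [X in _ + X]eq_bigr do rewrite !Phi10.
move=> /addIr.
have Phi0 t : Phi (0, t) = (cis (2 * pi * t) * 1) *: x.
  by rewrite /Phi /= subr0 scale0r addr0 mul1r mulr1.
have Phi1 t : Phi (1, t) = T x by rewrite /Phi /= subrr mul0r scale0r add0r scale1r.
rewrite [RHS]big1; last by move=> i _; rewrite !Phi1 subrr cres0.
rewrite (eq_bigr (fun=> - (2 * pi / N%:R))); last first.
  move=> i _.
  have WP t : cyclic_for T K ((cis (2 * pi * t) * 1) *: x).
    have -> : (cis (2 * pi * t) * 1) *: x = papply T (cis (2 * pi * t) *: 1) x.
      by rewrite mulr1 papplyZ papply1.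
    apply: (papply_cyclic cT ltr01 Kbd) => //.
    rewrite scaler_eq0 oner_eq0 orbF -modulus_gt0 modulus_cis//.
  rewrite !Phi0 (level_diff_phase cT OmM cis0 cisD ce cx a0 xa)//.
  have -> : 2 * pi * (i%:R / N%:R) - 2 * pi * (i.+1%:R / N%:R) = - (2 * pi / N%:R) :> R.
    by rewrite -natr1; field; rewrite gt_eqF.
  apply: cres_small => //; rewrite normrN gtr0_norm ?divr_gt0// ?mulr_gt0 ?pi_gt0//.
  by move: Npa; rewrite ltr_pdivlMr ?mulr_gt0 ?pi_gt0// mulrC.
rewrite sumr_const card_ord mulNrn -[_ *+ N]mulr_natr divfK ?gt_eqF// => /eqP.
by rewrite oppr_eq0 mulf_eq0 pnatr_eq0 /= gt_eqF ?pi_gt0.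
Qed.

End CircleToPoint.

(** * From an annulus to the unit circle *)

(** Uniform continuity on [[0, 1]]. *)
Lemma grid_small (R : realType) (f : R -> R) (d : R) : 0 < d ->
  (forall t, 0 <= t <= 1 -> {for t, continuous f}) ->
  \forall N \near \oo, forall j : nat, (j < N)%N ->
    `|f (j.+1%:R / N%:R) - f (j%:R / N%:R)| < d.
Proof.
move=> d0 cf.
pose P (N : nat) (t : R) := forall s, `|t - s| <= N%:R^-1 -> `|f s - f t| < d.
have cov : \forall N \near \oo, `[0, 1] `<=` P N.
  have /compact_near_coveringP := @segment_compact R 0 1; apply => t.
  rewrite /= in_itv /= => t01.
  have d20 : 0 < d / 2 by rewrite divr_gt0.
  have /nbhs_ballP[r /= r0 rP] : \forall s \near t, `|f t - f s| < d / 2.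
    by apply: (cf t t01 [set y | `|f t - y| < d / 2]); exact: nbhsx_ballx.
  have r20 : 0 < r / 2 by rewrite divr_gt0.
  near=> t' N => s /= ts.
  have tt' : `|t - t'| < r / 2 by near: t'; exact: nbhsx_ballx.
  have Nr : N%:R^-1 < r / 2 by near: N; exact: near_invn_lt.
  have h1 : `|f t - f t'| < d / 2 by apply: rP; rewrite /ball /=; lra.
  have h2 : `|f t - f s| < d / 2.
    apply: rP; rewrite /ball /= -(subrKA t').
    by apply: le_lt_trans (ler_normD _ _) _; lra.
  rewrite -(subrKA (f t)); apply: le_lt_trans (ler_normD _ _) _.
  by rewrite distrC; lra.
apply: filterS2 (nbhs_infty_gt 0) cov => N N0 KP j jN.
have N0' : (0 : R) < N%:R by rewrite ltr0n.
apply: KP.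
  by rewrite /= in_itv/= divr_ge0 ?ler0n//= ler_pdivrMr// mul1r ler_nat ltnW.
by rewrite -mulrBl -natr1 opprD addrA subrr sub0r mulN1r normrN gtr0_norm ?invr_gt0.
Unshelve. all: by end_near. Qed.

Section AnnulusToCircle.
Context (R : realType) (X : normedModType R[i]) (T : {linear X -> X}).
Context (cT : continuous T).

Definition annulus (m M : R) : set R[i] := [set z | m <= modulus z <= M].

Definition cexpR (t : R) : R[i] := (expR t)%:C.

Lemma cexpR0 : cexpR 0 = 1.
Proof. by rewrite /cexpR expR0. Qed.

Lemma cexpRD s t : cexpR (s + t) = cexpR s * cexpR t.
Proof. by rewrite /cexpR expRD rmorphM. Qed.

Lemma cexpR_continuous : continuous (cexpR : R -> R[i]^o).
Proof. by apply: real_complex_continuous; exact: continuous_expR. Qed.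

Lemma unit_circle1 : @unit_circle R 1.
Proof. exact: ComplexField.Normc.normc1. Qed.

Lemma unit_circleM (a b : R[i]) : unit_circle a -> unit_circle b -> unit_circle (a * b).
Proof. by rewrite /unit_circle /= ComplexField.Normc.normcM => -> ->; rewrite mulr1. Qed.

Lemma polar_form (z : R[i]) : z != 0 ->
  exists2 b, unit_circle b & z = cexpR (ln (modulus z)) * b.
Proof.
rewrite -modulus_gt0 => z0; exists (z / (modulus z)%:C).
  rewrite /unit_circle /= ComplexField.Normc.normcM ComplexField.Normc.normcV.
  by rewrite modulus_real gtr0_norm// divff// gt_eqF.
rewrite /cexpR lnK ?posrE// mulrC divfK// -modulus_gt0 modulus_real normr_gt0.
by rewrite gt_eqF.
Qed.

Definition lerp (v w : X) (t : R) : X := (1 - t)%:C *: v + t%:C *: w.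

Lemma lerp_continuous (U : topologicalType) (v w : U -> X) (t : U -> R) :
  continuous v -> continuous w -> continuous t ->
  continuous (fun z => lerp (v z) (w z) (t z)).
Proof.
move=> cv cw ct z; apply: cvgD; apply: cvgZ; [|exact: cv| |exact: cw].
  apply: (@real_complex_continuous _ _ (fun z => 1 - t z)) => y.
  by apply: cvgB; [exact: cvg_cst|exact: ct].
exact: (@real_complex_continuous _ _ t).
Qed.

Section DiscreteScales.
Context (B : R).
Local Notation K := (phase_set (@unit_circle R) cexpR B).
Local Notation W := (cyclic_for T K).
Context (x : X) (cx : W x) (a : R) (a_gt0 : 0 < a).
Hypothesis xa : forall t, levels T (@unit_circle R) cexpR x x t <-> exists z : int, t = z%:~R * a.
Local Notation level := (level T (@unit_circle R) cexpR x).
Implicit Types (v w u : X) (N n : nat).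

Let Kbd z : K z -> expR (- B) <= modulus z <= expR B.
Proof.
move=> [t [b [tB b1 ->]]]; rewrite ComplexField.Normc.normcM b1 mulr1.
rewrite modulus_real gtr0_norm ?expR_gt0// !ler_expR -ler_norml.
exact: tB.
Qed.

Let W_papply (p : {poly R[i]}) : p.[1] != 0 -> W (papply T p x).
Proof.
move=> p1; apply: (papply_cyclic cT (expR_gt0 (- B)) Kbd) => //.
by apply: contraNN p1 => /eqP ->; rewrite horner0.
Qed.

(** The variation of the level along the segment from [v] to [w], computed in
[N] steps; for large [N] each step is short enough for its residue to be the
actual increment. *)
Definition seg_sum v w N : R :=
  \sum_(j < N) cres a (level (lerp v w (j.+1%:R / N%:R)) - level (lerp v w (j%:R / N%:R))).

(** The triangle is the image of the square under the cone with apex [u] over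
the segment from [v] to [w]. *)
Lemma triangle_sum v w u :
  (forall al be ga : R, 0 <= al -> 0 <= be -> 0 <= ga -> al + be + ga = 1 ->
     W (al%:C *: v + be%:C *: w + ga%:C *: u)) ->
  \forall N \near \oo, seg_sum v w N + seg_sum w u N = seg_sum v u N.
Proof.
move=> Wc.
pose Phi (z : R * R) := lerp (lerp v w z.2) u z.1.
have cPhi : continuous Phi.
  apply: lerp_continuous; [|by move=> z; exact: cvg_cst|by move=> z; exact: cvg_fst].
  by apply: lerp_continuous => z; [exact: cvg_cst|exact: cvg_cst|exact: cvg_snd].
have WPhi s t : 0 <= s <= 1 -> 0 <= t <= 1 -> W (Phi (s, t)).
  move=> /andP[s0 s1] /andP[t0 t1].
  rewrite /Phi /lerp /= scalerDr !scalerA -!rmorphM /=.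
  by apply: Wc; rewrite ?mulr_ge0 ?subr_ge0//; ring.
have := level_square cT unit_circleM cexpR0 cexpRD cexpR_continuous cx a_gt0 xa cPhi WPhi.
apply: filterS => N.
have lerp0 v' w' : lerp v' w' 0 = v' by rewrite /lerp subr0 scale1r scale0r addr0.
have lerp1 v' w' : lerp v' w' 1 = w' by rewrite /lerp subrr scale1r scale0r add0r.
have E0 (t : R) : Phi (0, t) = lerp v w t by rewrite /Phi lerp0.
have E1 (t : R) : Phi (1, t) = u by rewrite /Phi lerp1.
have F0 (s : R) : Phi (s, 0) = lerp v u s by rewrite /Phi /= lerp0.
have F1 (s : R) : Phi (s, 1) = lerp w u s by rewrite /Phi /= lerp1.
under eq_bigr do rewrite !E0.
under [X in _ + X]eq_bigr do rewrite !F1.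
under [X in _ = X + _]eq_bigr do rewrite !F0.
rewrite [X in _ = _ + X]big1 ?addr0// => j _.
by rewrite !E1 subrr cres0.
Qed.

Lemma seg_sum_iter n N :
  seg_sum (iter n T x) (iter n T (T x)) N = seg_sum x (T x) N.
Proof.
apply: eq_bigr => j _.
have lerpT t : lerp (iter n T x) (iter n T (T x)) t = iter n T (lerp x (T x) t).
  by rewrite /lerp iter_linearD !iter_linearZ.
have lerpW t k : W (iter k T (lerp x (T x) t)).
  have -> : iter k T (lerp x (T x) t) =
      papply T ((1 - t)%:C *: ('X^k : {poly R[i]}) + t%:C *: ('X^(k.+1) : {poly R[i]})) x.
    by rewrite papplyD !papplyZ !papplyXn /lerp iter_linearD !iter_linearZ iterSr.
  apply: W_papply; rewrite hornerD !hornerZ !hornerXn !expr1n !mulr1 -rmorphD /= subrK.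
  exact: oner_neq0.
rewrite !lerpT.
rewrite (level_diff_iter cT unit_circle1 unit_circleM cexpR0 cexpRD cexpR_continuous
  cx a_gt0 xa)//; exact: (lerpW _ 0%N).
Qed.

(** The triangles with vertices [x], [T^n x], [T^(n+1) x] consist of vectors
[p(T) x] with [p(1) = 1]; and [T] preserves levels, so each step of the orbit
contributes the same variation. *)
Lemma seg_sum_orbit n :
  \forall N \near \oo, seg_sum x (iter n T x) N = n%:R * seg_sum x (T x) N.
Proof.
elim: n => [|n IH].
  apply: nearW => N; rewrite mul0r; apply: big1 => j _.
  have lerpxx t : lerp x x t = x by rewrite /lerp -scalerDl -rmorphD /= subrK scale1r.
  by rewrite !lerpxx subrr cres0.
have tri := @triangle_sum x (iter n T x) (iter n.+1 T x).
apply: filterS2 IH (tri _) => [N E <-|al be ga a0 b0 g0 abg].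
  by rewrite E iterSr seg_sum_iter -natr1 mulrDl mul1r.
have -> : al%:C *: x + be%:C *: iter n T x + ga%:C *: iter n.+1 T x =
    papply T (al%:C *: (1 : {poly R[i]}) + be%:C *: ('X^n : {poly R[i]})
              + ga%:C *: ('X^(n.+1) : {poly R[i]})) x.
  by rewrite !papplyD !papplyZ papply1 !papplyXn.
apply: W_papply; rewrite !hornerD !hornerZ !hornerXn hornerC !expr1n !mulr1.
by rewrite -!rmorphD /= abg oner_neq0.
Qed.

(** The plane cut along the negative real half-line: the segment from 1 to such
a number avoids 0. *)
Definition slit (z : R[i]) := complex.Im z != 0 \/ 0 < complex.Re z.

Lemma slit_conv (z : R[i]) (al be : R) : slit z -> 0 <= al -> 0 <= be -> 0 < al + be ->
  al%:C + be%:C * z != 0.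
Proof.
case: z => u v sz al0 be0 ab; apply/eqP => /eqP.
rewrite eq_complex /= !mul0r !subr0 !addr0 add0r => /andP[/eqP h1 /eqP h2].
case: sz => /= [v0|u0]; last by have := mulr_ge0 be0 (ltW u0); nra.
have be00 : be = 0 by apply/eqP; move/eqP: h2; rewrite mulf_eq0 (negPf v0) orbF.
by move: h1 ab; rewrite be00; lra.
Qed.

Lemma slit_perturb (z : R[i]) (y v : X) (d : R) : z != 0 -> nr (y - z *: v) < d ->
  exists z', [/\ slit z', modulus z <= modulus z' <= 2 * modulus z & nr (y - z' *: v) < d].
Proof.
move=> z0 yd; have [sz|nsz] := pselect (slit z).
  by exists z; split=> //; rewrite lexx /=; have := modulus_ge0 z; lra.
have {nsz} zE : complex.Im z = 0.
  by apply: contrapT => h; apply: nsz; left; apply/eqP.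
have [rz uE] : exists rz : R, z = rz +i* 0.
  by exists (complex.Re z); case: (z) zE => ? ? /= ->.
rewrite -modulus_gt0 in z0.
(* An imaginary part small enough to keep the approximation, and at most the
   modulus of [z] so that the modulus at most doubles. *)
pose eta := Order.min (modulus z) ((d - nr (y - z *: v)) / (nr v + 1)).
have v1 : 0 < nr v + 1 by rewrite ltr_wpDl// nr_ge0.
have eta0 : 0 < eta by rewrite lt_min z0 divr_gt0// subr_gt0.
have etaz : eta <= modulus z by rewrite ge_min lexx.
have etad : eta * (nr v + 1) <= d - nr (y - z *: v).
  by rewrite -ler_pdivlMr// ge_min lexx orbT.
have modi : modulus (0 +i* eta) = eta.
  by rewrite /= expr0n add0r sqrtr_sqr gtr0_norm.
exists (z + (0 +i* eta)); split.
- by left; rewrite uE /= add0r gt_eqF.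
- apply/andP; split.
    rewrite uE /= addr0 add0r expr0n addr0.
    by rewrite ler_wsqrtr// lerDl sqr_ge0.
  have := le_normcD z (0 +i* eta); rewrite modi; lra.
- rewrite scalerDl opprD addrA; apply: le_lt_trans (nrB _ _) _.
  by rewrite nrZ modi; have := nr_ge0 v; nra.
Qed.

Lemma nr_continuous (Y : normedModType R[i]) : continuous (@nr R Y).
Proof.
move=> y C /nbhs_ballP[d /= d0 dC]; apply/nbhs_nrP; exists d => // w yw.
apply: dC; rewrite /ball /= ltr_norml.
by have := nr_dist y w 0; have := nr_dist w y 0; rewrite (nr_distC w y) !subr0; lra.
Qed.

(** On the line spanned by [x] the level is minus the logarithm of the modulus,
up to a constant and modulo [a]. *)
Lemma seg_sum_scale (z : R[i]) :
  (forall t, 0 <= t <= 1 -> (1 - t)%:C + t%:C * z != 0) ->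
  \forall N \near \oo, seg_sum x (z *: x) N = - ln (modulus z).
Proof.
move=> zt0; pose zt (t : R) := (1 - t)%:C + t%:C * z.
have czt : continuous (zt : R -> R[i]^o).
  move=> t; apply: cvgD.
    apply: (@real_complex_continuous _ _ (fun t : R => 1 - t)) => s.
    by apply: cvgB; [exact: cvg_cst|exact: cvg_id].
  apply: (@cvgM R[i] R); last exact: cvg_cst.
  by apply: (@real_complex_continuous _ _ (@id R)) => s; exact: cvg_id.
have ctn (t : R) : 0 <= t <= 1 -> {for t, continuous (fun t => ln (modulus (zt t)))}.
  move=> t01; apply: (@continuous_comp _ _ _ (fun t => modulus (zt t)) (@ln R)).
    have -> : (fun t => modulus (zt t)) = @nr R (R[i]^o) \o (zt : R -> R[i]^o).
      by apply/funext => s /=; rewrite nr_regular.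
    by apply: continuous_comp; [exact: czt|exact: nr_continuous].
  by apply: continuous_ln; rewrite modulus_gt0 zt0.
have a20 : 0 < a / 2 by rewrite divr_gt0.
apply: filterS2 (nbhs_infty_gt 0) (grid_small a20 ctn) => N N0 small.
have N0' : (0 : R) < N%:R by rewrite ltr0n.
have jN01 (j : nat) : (j <= N)%N -> 0 <= (j%:R / N%:R : R) <= 1.
  by move=> jN; rewrite divr_ge0 ?ler0n//= ler_pdivrMr// mul1r ler_nat.
have lerpE t : lerp x (z *: x) t = zt t *: x by rewrite /lerp scalerA -scalerDl.
have Wz c : c != 0 -> W (c *: x).
  move=> c0; have -> : c *: x = papply T (c *: 1) x by rewrite papplyZ papply1.
  by apply: W_papply; rewrite hornerZ hornerC mulr1.
rewrite /seg_sum (eq_bigr (fun j : 'I_N =>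
    - (ln (modulus (zt (j.+1%:R / N%:R))) - ln (modulus (zt (j%:R / N%:R)))))); last first.
  move=> j _; rewrite !lerpE.
  have h1 := zt0 _ (jN01 _ (ltn_ord j)); have h2 := zt0 _ (jN01 _ (ltnW (ltn_ord j))).
  have [b1 o1 E1] := polar_form h1; have [b2 o2 E2] := polar_form h2.
  have W1 := Wz _ h1; have W2 := Wz _ h2.
  rewrite E1 in W1; rewrite E2 in W2.
  have := level_diff_phase cT unit_circleM cexpR0 cexpRD cexpR_continuous cx a_gt0 xa
    o2 o1 W2 W1.
  rewrite -E1 -E2 => ->; rewrite opprB; apply: cres_small => //.
  by rewrite distrC small.
pose lnz (j : nat) := ln (modulus (zt (j%:R / N%:R))).
rewrite sumrN -(big_mkord xpredT (fun j => lnz j.+1 - lnz j)).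
rewrite telescope_sumr// /lnz divff ?gt_eqF// mul0r /zt subrr subr0 add0r mul1r mul0r addr0.
by rewrite ComplexField.Normc.normc1 ln1 subr0.
Qed.

Lemma seg_sum_small (th : nat -> R) (c : R) N :
  (forall j, (j <= N)%N -> `|cres a (th j - c)| < a / 8) ->
  `|\sum_(j < N) cres a (th j.+1 - th j)| < a / 4.
Proof.
move=> h; have a0 := a_gt0.
rewrite (eq_bigr (fun j : 'I_N => cres a (th j.+1 - c) - cres a (th j - c))); last first.
  move=> j _; have h1 := h _ (ltn_ord j); have h2 := h _ (ltnW (ltn_ord j)).
  by rewrite -cresB//; [congr cres; ring|lra|lra].
rewrite -(big_mkord xpredT (fun j => cres a (th j.+1 - c) - cres a (th j - c))).
rewrite (telescope_sumr (fun j => cres a (th j - c)))//.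
have h1 := h N (leqnn _); have h2 := h 0%N (leq0n _).
by apply: le_lt_trans (ler_normB _ _) _; lra.
Qed.

(** Choose [l] and [n] with [l *: T^n x] close to [r *: x], [l] being off the
negative half-line.  The triangle with vertices [x], [T^n x] and [(r / l) x]
expresses the variation along [x], [T^n x] as that along [x], [(r / l) x],
which is [ln `|l| - ln r], minus a small one. *)
Lemma seg_sum_drift (r : R) : 0 < r -> exists n,
  \forall N \near \oo, `|n%:R * seg_sum x (T x) N + ln r| <= B + ln 2 + a / 4.
Proof.
move=> r0.
have rC0 : r%:C != 0 by rewrite -modulus_gt0 modulus_real normr_gt0 gt_eqF.
have Wr : W (r%:C *: x).
  have -> : r%:C *: x = papply T (r%:C *: 1) x by rewrite papplyZ papply1.
  by apply: W_papply; rewrite hornerZ hornerC mulr1.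
have /nbhs_nrP[d d0 dP] :=
  level_continuous cT unit_circleM cexpR0 cexpRD cexpR_continuous cx a_gt0 xa Wr.
have /closure_nrP/(_ d d0)[_ [l0 [n [Kl0 ->]]] near0] := @cx (r%:C *: x).
have /andP[l0B l0B'] := Kbd Kl0.
have l0p : 0 < modulus l0 by apply: lt_le_trans l0B; exact: expR_gt0.
have l00 : l0 != 0 by rewrite -modulus_gt0.
have [l [sl /andP[l1 l2] nearl]] := slit_perturb l00 near0.
have lp : 0 < modulus l by exact: lt_le_trans l1.
have l0' : l != 0 by rewrite -modulus_gt0.
have lnl : `|ln (modulus l)| <= B + ln 2.
  rewrite ler_norml; apply/andP; split.
    have : expR (- B) <= modulus l by exact: le_trans l1.
    rewrite -ler_ln ?posrE ?expR_gt0// expRK.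
    by have : 0 <= ln 2 :> R by [rewrite ln_ge0// ler1n]; lra.
  have : modulus l <= 2 * expR B by apply: le_trans l2 _; rewrite ler_wpM2l.
  rewrite -ler_ln ?posrE ?mulr_gt0 ?expR_gt0// lnM ?posrE ?expR_gt0// expRK.
  by rewrite addrC.
pose z := r%:C / l; pose L := iter n T x.
have tri : \forall N \near \oo, seg_sum x L N + seg_sum L (z *: x) N = seg_sum x (z *: x) N.
  apply: triangle_sum => al be ga al0 be0 ga0 abg.
  have -> : al%:C *: x + be%:C *: L + ga%:C *: (z *: x) =
      papply T (al%:C *: (1 : {poly R[i]}) + be%:C *: ('X^n : {poly R[i]})
                + (ga%:C * z) *: (1 : {poly R[i]})) x.
    by rewrite !papplyD !papplyZ papply1 papplyXn scalerA.
  apply: W_papply; rewrite !hornerD !hornerZ hornerXn hornerC !expr1n !mulr1.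
  have -> : al%:C + be%:C + ga%:C * z = ((ga * r)%:C + (al + be)%:C * l) / l.
    by rewrite /z rmorphM rmorphD /=; field.
  rewrite mulf_neq0 ?invr_eq0// slit_conv ?mulr_ge0 ?addr_ge0 ?(ltW r0)//.
  by nra.
have zt0 t : 0 <= t <= 1 -> (1 - t)%:C + t%:C * z != 0.
  move=> /andP[t0 t1].
  have -> : (1 - t)%:C + t%:C * z = ((t * r)%:C + (1 - t)%:C * l) / l.
    by rewrite /z rmorphM /=; field.
  rewrite mulf_neq0 ?invr_eq0// slit_conv ?mulr_ge0 ?subr_ge0 ?(ltW r0)//.
  by nra.
exists n.
apply: filterS2 (nbhs_infty_gt 0)
  (filterI (seg_sum_orbit n) (filterI tri (seg_sum_scale zt0))) => N N0.
move=> [E1 [E2 E3]].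
have N0' : (0 : R) < N%:R by rewrite ltr0n.
have jN01 (j : nat) : (j <= N)%N -> 0 <= (j%:R / N%:R : R) <= 1.
  by move=> jN; rewrite divr_ge0 ?ler0n//= ler_pdivrMr// mul1r ler_nat.
have small : `|seg_sum L (z *: x) N| < a / 4.
  pose w (t : R) := lerp (l *: L) (r%:C *: x) t.
  have lw t : l *: lerp L (z *: x) t = w t.
    rewrite /w /lerp scalerDr !scalerA [l * (1 - t)%:C]mulrC.
    by congr (_ + _ *: _); rewrite /z; field.
  have Ww t : 0 <= t <= 1 -> W (w t).
    move=> /andP[t0 t1].
    have -> : w t = papply T (((1 - t)%:C * l) *: ('X^n : {poly R[i]})
                              + (t * r)%:C *: (1 : {poly R[i]})) x.
      by rewrite papplyD !papplyZ papply1 papplyXn /w /lerp !scalerA rmorphM.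
    apply: W_papply; rewrite hornerD !hornerZ hornerXn hornerC expr1n !mulr1.
    by rewrite addrC slit_conv ?mulr_ge0 ?subr_ge0 ?(ltW r0)//; nra.
  have [b ob lE] := polar_form l0'.
  have := @seg_sum_small (fun j => level (w (j%:R / N%:R))) (level (r%:C *: x)) N.
  have -> : seg_sum L (z *: x) N =
      \sum_(j < N) cres a (level (w (j.+1%:R / N%:R)) - level (w (j%:R / N%:R))).
    apply: eq_bigr => j _.
    have w1 := Ww _ (jN01 _ (ltn_ord j)); have w2 := Ww _ (jN01 _ (ltnW (ltn_ord j))).
    rewrite -!lw lE in w1 w2 *.
    by rewrite (level_diff_scale cT unit_circleM cexpR0 cexpRD cexpR_continuous cx a_gt0 xa).
  apply => j jN; have t01 := jN01 _ jN; apply: dP; last exact: Ww.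
  move: t01; move: (j%:R / N%:R) => t /andP[t0 t1].
  have -> : r%:C *: x - w t = (1 - t)%:C *: (r%:C *: x - l *: L).
    rewrite /w /lerp scalerBr.
    have -> : (1 - t)%:C *: (r%:C *: x) = r%:C *: x - t%:C *: (r%:C *: x).
      by rewrite rmorphB rmorph1 scalerBl scale1r.
    by rewrite opprD addrA addrAC.
  rewrite nrZ modulus_real ger0_norm ?subr_ge0//; apply: le_lt_trans nearl.
  by rewrite ler_piMl ?nr_ge0// gerBl.
have lnz : ln (modulus z) = ln r - ln (modulus l).
  rewrite /z ComplexField.Normc.normcM ComplexField.Normc.normcV modulus_real gtr0_norm//.
  by rewrite lnM ?lnV ?posrE ?invr_gt0.
rewrite lnz in E3; rewrite E1 in E2.
move: small lnl; rewrite ltr_norml !ler_norml => /andP[? ?] /andP[? ?].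
by apply/andP; split; lra.
Qed.

(** The variation from [x] to [T x] would have to be negative, seen with [r]
large, and positive, seen with [r] small. *)
Lemma discrete_scales_absurd : False.
Proof.
(* One more than the error bound in [seg_sum_drift]. *)
pose C := B + ln 2 + a / 4 + 1.
have [n1 h1] := seg_sum_drift (expR_gt0 C).
have [n2 h2] := seg_sum_drift (expR_gt0 (- C)).
have [N [+ +]] := filter_ex (filterI h1 h2).
rewrite !expRK /C !ler_norml => /andP[_ k1] /andP[k2 _].
have n10 : 0 <= n1%:R :> R by rewrite ler0n.
have n20 : 0 <= n2%:R :> R by rewrite ler0n.
have s1 : n1%:R * seg_sum x (T x) N < 0 by lra.
have s2 : 0 < n2%:R * seg_sum x (T x) N by lra.
have [S0|S0] := leP 0 (seg_sum x (T x) N).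
  by have := mulr_ge0 n10 S0; lra.
by have := mulr_ge0_le0 n20 (ltW S0); lra.
Qed.

End DiscreteScales.

Lemma annulus_to_circle (m M : R) x : 0 < m ->
  cyclic_for T (annulus m M) x -> cyclic_for T (@unit_circle R) x.
Proof.
move=> m0 cx0; pose B := `|ln m| + `|ln M|.
have cx : cyclic_for T (phase_set (@unit_circle R) cexpR B) x.
  apply: cyclic_for_sub cx0 => z /andP[mz zM].
  have z0 : 0 < modulus z by exact: lt_le_trans mz.
  have z00 : z != 0 by rewrite -modulus_gt0.
  have [b ob zE] := polar_form z00; rewrite zE.
  exists (ln (modulus z)), b; split=> //.
  have h1 : ln m <= ln (modulus z) by rewrite ler_ln.
  have h2 : ln (modulus z) <= ln M by rewrite ler_ln ?posrE//; exact: lt_le_trans zM.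
  have := ler_norm (ln M); have := ler_norm (- ln m); rewrite normrN => h3 h4.
  have := normr_ge0 (ln M); have := normr_ge0 (ln m); rewrite ler_norml /B => h5 h6.
  by apply/andP; split; lra.
have [//|[a a0 xa]] := levels_dichotomy cT
  unit_circle1 unit_circleM cexpR0 cexpRD cexpR_continuous cx.
by have := discrete_scales_absurd cx a0 xa.
Qed.

(** Density of the orbit scaled by an annulus already makes [x] hypercyclic: an
extension of the theorem of Leon-Saavedra and Mueller. *)
Lemma annulus_to_point (m M : R) x : 0 < m ->
  cyclic_for T (annulus m M) x -> cyclic_for T [set 1] x.
Proof. by move=> m0 /(annulus_to_circle m0); exact: circle_to_point. Qed.

End AnnulusToCircle.

(** * Bounded scalar sets, away from zero, are F-hypercyclic scalar sets *)

Lemma infinite_dimensional_neq0 (K : fieldType) (V : lmodType K) :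
  infinite_dimensional V -> exists v : V, v != 0.
Proof.
move=> infV; apply: contrapT => /forallNP h.
apply: (infV 0%N (fun=> 0)) => v; exists (fun=> 0); rewrite big_ord0.
by apply/eqP/negP => /negP; exact: h.
Qed.

Section PartitionRegular.
Context (R : realType) (F : set (set nat)) (Gamma : set R[i]).
Hypothesis hF : furstenberg_family F.
Context (Y : normedModType R[i]) (S : {linear Y -> Y}) (cS : continuous S).
Context (e : Y) (e0 : e != 0).
Context (m M : R) (m0 : 0 < m) (M0 : 0 < M).
Hypothesis Gamma_annulus : (Gamma `\ 0) `<=` annulus m M.

Lemma nr_gt0 (v : Y) : v != 0 -> 0 < nr v.
Proof.
move=> v0; rewrite lt_neqAle nr_ge0 andbT eq_sym.
by apply: contraNN v0 => /eqP/nr_eq0 ->.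
Qed.

Lemma nbhs_neq0 (v : Y) (B : set Y) : nbhs v B -> exists2 w, w != 0 & nbhs w B.
Proof.
have [-> B0|v0 Bv] := eqVneq v 0; last by exists v.
move: B0; rewrite nbhsE => -[V [oV V0] VB].
have ep := nr_gt0 e0.
have /nbhs_nrP[d d0 dV] : nbhs 0 V by exact: open_nbhs_nbhs.
exists ((d / 2 / nr e)%:C *: e).
  rewrite scaler_eq0 negb_or e0 andbT -modulus_gt0 modulus_real normr_gt0.
  by rewrite gt_eqF// !divr_gt0.
rewrite nbhsE; exists V => //; split=> //; apply: dV.
rewrite sub0r nrN nrZ modulus_real gtr0_norm ?divr_gt0// divfK ?gt_eqF//.
by lra.
Qed.

Lemma open_neq0 : open [set v : Y | v != 0].
Proof.
rewrite openE => v /= v0; apply/nbhs_nrP; exists (nr v); first exact: nr_gt0.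
by move=> w; apply: contraTN => /eqP ->; rewrite subr0 ltxx.
Qed.

Lemma hypercyclic_cyclic (y : Y) : hypercyclic_vector F Gamma S y ->
  cyclic_for S (annulus m M) y.
Proof.
case: hF => F0 _ _ hy v B /nbhs_neq0[w w0].
rewrite nbhsE => -[V [oV Vw] VB].
have V0 : (V `&` [set u | u != 0]) !=set0 by exists w.
have := hy _ (openI oV open_neq0) V0.
set E := [set n | _] => FE.
have [n [_ [[_ [l Gl <-] <-] [Vz z0]]]] : E !=set0.
  by apply/set0P/eqP => E0; rewrite E0 in FE.
exists (iter n S (l *: y)); split; last exact: VB.
exists l, n; split; last by rewrite iter_linearZ.
apply: Gamma_annulus; split => //= l0.
by move: z0; rewrite /= iter_linearZ l0 scale0r eqxx.
Qed.

(** Since [y] is hypercyclic, every [l^-1 *: y] with [l] in the annulus enters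
[U] at some time, and by compactness at a time at most [k0] that also works for
all vectors near [y].  So each visit of the scaled orbit near [y] is followed,
with delay at most [k0], by a visit of the orbit to [U].  Partition regularity
picks one delay, and right invariance shifts the set of times by it. *)
Lemma hypercyclic_vector_point (y : Y) :
  right_invariant F -> finite_union_closed (~` F) ->
  hypercyclic_vector F Gamma S y -> hypercyclic_vector F [set 1] S y.
Proof.
move=> riF fuF hy; case: hF => _ _ upF.
have cy : cyclic_for S [set 1] y.
  exact: (annulus_to_point cS m0 (hypercyclic_cyclic hy)).
have y0 : y != 0.
  apply/eqP => y0; have /closure_nrP/(_ _ (nr_gt0 e0))[_ [l [n [_ ->]]]] := cy e.
  have -> : iter n S y = 0 by rewrite y0 -[0](scale0r 0) iter_linearZ !scale0r.
  by rewrite scaler0 subr0 ltxx.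
move=> U oU U0.
(* Polar coordinates exhibit the inverses of the annulus as the image of a
   compact rectangle. *)
pose phi (z : R * R) : R[i] := z.1%:C * cis z.2.
have cphi : continuous (phi : R * R -> R[i]^o).
  have -> : phi = fun z : R * R => (z.1 * cos z.2) +i* (z.1 * sin z.2).
    by apply/funext => z; rewrite /phi /cis; simpc.
  apply: complex_continuous => z; apply: cvgM; try exact: cvg_fst.
    by apply: continuous_comp; [exact: cvg_snd|exact: continuous_cos].
  by apply: continuous_comp; [exact: cvg_snd|exact: continuous_sin].
pose K : set (R * R) := `[M^-1, m^-1]%classic `*` `[- pi, pi]%classic.
have cK : compact K by apply: compact_setX; exact: segment_compact.
have phiK l : annulus m M l -> exists2 z, K z & phi z = l^-1.
  move=> /andP[ml lM]; have lp : 0 < modulus l by exact: lt_le_trans ml.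
  have l0 : l != 0 by rewrite -modulus_gt0.
  have [b ob E] := polar_form (invr_neq0 l0).
  have [t tpi bE] := cis_surj ob.
  exists ((modulus l)^-1, t).
    split; rewrite /= in_itv /=; last by rewrite -ler_norml.
    by rewrite !lef_pV2 ?posrE// lM ml.
  rewrite E bE /phi /cexpR /= lnK; first by rewrite ComplexField.Normc.normcV.
  by rewrite posrE modulus_gt0 invr_neq0.
have phi0 z : K z -> phi z != 0.
  case: z => r t [/=]; rewrite in_itv /= => /andP[rM rm] _.
  have r0 : 0 < r by apply: lt_le_trans rM; rewrite invr_gt0.
  rewrite /phi -modulus_gt0 ComplexField.Normc.normcM modulus_cis mulr1.
  by rewrite modulus_real normr_gt0 gt_eqF.
pose P (p : nat * Y) z := exists2 n, (n <= p.1)%N & U (phi z *: iter n S p.2).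
have cov : \forall p \near filter_prod \oo (nbhs y), K `<=` P p.
  have /compact_near_coveringP cK' := cK.
  apply: (cK' _ (filter_prod \oo (nbhs y)) P) => z Kz.
  have [u Uu] := U0.
  have hU : nbhs (phi z *: ((phi z)^-1 *: u)) U.
    by rewrite scalerA divff ?phi0// scale1r; exact: open_nbhs_nbhs.
  have [_ [[_ [n [-> ->]]] Un]] := cy _ _ (scaler_continuous hU).
  rewrite /= scale1r in Un.
  have cn : continuous (fun q : (R * R) * Y => phi q.1 *: iter n S q.2).
    move=> q; apply: cvgZ.
      apply: (@continuous_comp _ _ (R[i]^o) (@fst (R * R)%type Y) phi).
        exact: cvg_fst.
      exact: cphi.
    apply: (@continuous_comp _ _ _ (@snd (R * R)%type Y) (iter n S)).
      exact: cvg_snd.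
    exact: iter_continuous.
  have := cn (z, y) U (open_nbhs_nbhs (conj oU Un)).
  move=> [[A B] /= [zA yB] AB].
  exists (A, [set p | (n <= p.1)%N /\ B p.2]) => /=.
    split=> //; exists ([set k | (n <= k)%N], B) => /=; last by move=> [? ?].
    by split=> //; exact: nbhs_infty_ge.
  move=> [z' [k v]] /= [Az' [nk Bv]]; exists n => //.
  exact: (AB (z', v)).
have [[N V] /= [[k0 _ Nk] yV] cov'] := cov.
have := yV; rewrite nbhsE => -[V' [oV' V'y] V'V].
have FE := hy _ (openI oV' open_neq0) (ex_intro _ y (conj V'y y0)).
set E := [set n | _] in FE.
pose En n := [set k | U (iter (k + n) S y)].
have [n FEn] : exists n, F (En n).
  apply: contrapT => /forallNP nF; have := fuF k0.+1 En (fun i _ => nF i); apply.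
  apply: upF FE => k [_ [[_ [l Gl <-] <-] [V'z z0]]].
  have lan : annulus m M l.
    apply: Gamma_annulus; split=> //= l0.
    by move: z0; rewrite /= iter_linearZ l0 scale0r eqxx.
  have l0 : l != 0 by rewrite -modulus_gt0; apply: lt_le_trans m0 _; case/andP: lan.
  have [z Kz zE] := phiK _ lan.
  have [|n nk0 Un] := cov' (k0, iter k S (l *: y)) _ z Kz.
    by split=> /=; [exact: (Nk k0 (leqnn _))|exact: V'V].
  exists n => //; rewrite /En /=; move: Un.
  by rewrite zE iter_linearZ /= iter_linearZ scalerA mulVf// scale1r -iterD addnC.
apply: upF ((riF _).1 FEn n) => _ [k Uk <-].
exists (iter (n + k) S y); split; last by rewrite addnC.
by exists y => //; exists 1 => //; rewrite scale1r.
Qed.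

Lemma hypercyclic_vector_of_point (y : Y) l : Gamma l -> l != 0 ->
  hypercyclic_vector F [set 1] S y -> hypercyclic_vector F Gamma S y.
Proof.
case: hF => _ _ upF Gl l0 hy U oU [u Uu].
have oV : open ((fun v => l *: v) @^-1` U).
  by apply: open_comp => // v _; exact: scaler_continuous.
have V0 : ((fun v => l *: v) @^-1` U) !=set0.
  by exists (l^-1 *: u); rewrite /= scalerA divff// scale1r.
apply: upF (hy _ oV V0) => n [_ [[_ [_ -> <-] <-] Uz]].
exists (l *: iter n S y); split; last by move: Uz; rewrite /= scale1r.
by exists (l *: y); [exists l|rewrite iter_linearZ].
Qed.

End PartitionRegular.

(** * The Banach space of sequences c with c_i / 2^i -> 0 *)

Section WeightedC0.
Context (R : realType).
Implicit Types (e : R) (i N : nat).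

Definition vanishing (c : nat -> R[i]) : Prop :=
  forall e, 0 < e -> exists N, forall i, (N <= i)%N -> modulus (c i) <= e * 2 ^+ i.

Definition vanishing_pred : {pred nat -> R[i]} := fun c => `[< vanishing c >].

Lemma vanishing_predP c : reflect (vanishing c) (c \in vanishing_pred).
Proof. exact: asboolP. Qed.

Lemma modulusD (z w : R[i]) : modulus (z + w) <= modulus z + modulus w.
Proof. exact: le_normcD. Qed.

Lemma vanishing_submod : submod_closed vanishing_pred.
Proof.
split; first by apply/vanishing_predP => e e0; exists 0%N => i _;
  rewrite ComplexField.Normc.normc0 mulr_ge0 ?exprn_ge0 ?(ltW e0).
move=> a c d /vanishing_predP hc /vanishing_predP hd; apply/vanishing_predP => e e0.
have a1 : 0 < 2 * (modulus a + 1) by rewrite mulr_gt0// ltr_wpDl// modulus_ge0.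
have [N1 h1] := hc (e / (2 * (modulus a + 1))) (divr_gt0 e0 a1).
have e20 : 0 < e / 2 by rewrite divr_gt0.
have [N2 h2] := hd (e / 2) e20.
exists (maxn N1 N2) => i; rewrite geq_max => /andP[/h1 {}h1 /h2 {}h2].
apply: le_trans (modulusD _ _) _; rewrite ComplexField.Normc.normcM.
have {}h1 : modulus a * modulus (c i) <= e / 2 * 2 ^+ i.
  apply: (@le_trans _ _ ((modulus a + 1) * (e / (2 * (modulus a + 1)) * 2 ^+ i))).
    by rewrite ler_pM ?modulus_ge0// lerDl.
  rewrite mulrA ler_wpM2r ?exprn_ge0// le_eqVlt; apply/orP; left; apply/eqP.
  by field; rewrite gt_eqF// ltr_wpDl// modulus_ge0.
by rewrite [leRHS](_ : _ = e / 2 * 2 ^+ i + e / 2 * 2 ^+ i); [exact: lerD|field].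
Qed.

HB.instance Definition _ := GRing.isSubmodClosed.Build R[i] (nat -> R[i])
  vanishing_pred vanishing_submod.

Record wc0 := Wc0 { wval :> nat -> R[i]; wvalP : wval \in vanishing_pred }.

HB.instance Definition _ := [isSub for wval].
HB.instance Definition _ := [Choice of wc0 by <:].
HB.instance Definition _ := [SubChoice_isSubLmodule of wc0 by <:].

Implicit Types (c d : wc0).

Lemma wc0_ext c d : (forall i, c i = d i) -> c = d.
Proof. by move=> h; apply: val_inj; apply/funext. Qed.

Definition wnorm c : R := sup (range (fun i => modulus (c i) / 2 ^+ i)).

Lemma wnorm_has_sup c : has_sup (range (fun i => modulus (c i) / 2 ^+ i)).
Proof.
split; first by exists (modulus (c 0%N) / 2 ^+ 0); exists 0%N.
have [N h] := (vanishing_predP _ (wvalP c)) 1 ltr01.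
exists (1 + \sum_(i < N) modulus (c i) / 2 ^+ i) => _ [i _ <-].
have pos j : 0 <= modulus (c j) / 2 ^+ j by rewrite divr_ge0 ?modulus_ge0 ?exprn_ge0.
have [Ni|iN] := leqP N i.
  rewrite ler_wpDr ?sumr_ge0// ler_pdivrMr ?exprn_gt0//; exact: h.
rewrite ler_wpDl// (bigD1 (Ordinal iN))//= lerDl; exact: sumr_ge0.
Qed.

Lemma wnorm_coord c i : modulus (c i) <= wnorm c * 2 ^+ i.
Proof.
rewrite -ler_pdivrMr ?exprn_gt0//; apply: ub_le_sup; last by exists i.
by case: (wnorm_has_sup c).
Qed.

Lemma wnorm_le c (M : R) : (forall i, modulus (c i) <= M * 2 ^+ i) -> wnorm c <= M.
Proof.
move=> h; apply: ge_sup; first by case: (wnorm_has_sup c).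
by move=> _ [i _ <-]; rewrite ler_pdivrMr ?exprn_gt0.
Qed.

Lemma wnorm_ge0 c : 0 <= wnorm c.
Proof.
by have := wnorm_coord c 0; rewrite expr0 mulr1; apply: le_trans; exact: modulus_ge0.
Qed.

Lemma wnormD c d : (wnorm (c + d))%:C <= (wnorm c)%:C + (wnorm d)%:C.
Proof.
rewrite -rmorphD lecR; apply: wnorm_le => i; apply: le_trans (modulusD _ _) _.
by rewrite mulrDl lerD// wnorm_coord.
Qed.

Lemma wnormZ_le (a : R[i]) c : wnorm (a *: c) <= modulus a * wnorm c.
Proof.
apply: wnorm_le => i; rewrite ComplexField.Normc.normcM -mulrA.
by rewrite ler_wpM2l ?modulus_ge0// wnorm_coord.
Qed.

Lemma wnormZ (a : R[i]) c : (wnorm (a *: c))%:C = `|a| * (wnorm c)%:C.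
Proof.
rewrite normrC -rmorphM /=; congr _%:C; apply/eqP.
rewrite eq_le wnormZ_le /=.
have [->|a0] := eqVneq a 0.
  by rewrite ComplexField.Normc.normc0 mul0r wnorm_ge0.
have ap : 0 < modulus a by rewrite modulus_gt0.
have := wnormZ_le a^-1 (a *: c).
rewrite scalerA mulVf// scale1r ComplexField.Normc.normcV.
by rewrite mulrC ler_pdivlMr// mulrC.
Qed.

Lemma wnorm_eq0 c : (wnorm c)%:C = 0 -> c = 0.
Proof.
move=> /(congr1 (@complex.Re R)) /= c0; apply: wc0_ext => i.
apply: ComplexField.Normc.eq0_normc; apply/eqP; rewrite eq_le modulus_ge0 andbT.
by have := wnorm_coord c i; rewrite c0 mul0r.
Qed.

HB.instance Definition _ := Lmodule_isNormed.Build R[i] wc0 wnormD wnormZ wnorm_eq0.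

Lemma nr_wnorm c : nr c = wnorm c.
Proof. by []. Qed.

(** Completeness is obtained coordinatewise.  Lipschitz functionals converge
along a Cauchy filter, and the limit keeps the distance bound to the centre of
any ball of the filter. *)
Lemma wc0_lipschitz_lim (F : set_system wc0) (FF : ProperFilter F) :
  cauchy F -> forall (f : wc0 -> R) (K : R), 0 < K ->
  (forall c d, `|f c - f d| <= K * nr (c - d)) ->
  exists l, forall c e, F (ball c e%:C) -> `|l - f c| <= K * e.
Proof.
move=> cF f K K0 fK.
have cfF : cauchy (f @ F).
  apply: cauchy_exP => e e0.
  have eK0 : 0 < (e / K)%:C by rewrite ltcR divr_gt0.
  have [c Fc] := (cauchyP F).1 cF _ eK0.
  exists (f c); suff : F [set d | `|f c - f d| < e] by [].
  apply: filterS Fc => d /ball_nr cd /=; apply: le_lt_trans (fK _ _) _.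
  by rewrite mulrC -ltr_pdivlMr.
have fl := R_complete _ cfF; set l := lim _ in fl.
exists l => c e Fc; apply/ler_addgt0Pr => d d0.
have Fd : F [set y | `|l - f y| < d].
  have ld : nbhs l (ball l d) by exact: nbhsx_ballx.
  exact: fl ld.
have [y [/ball_nr cy ly]] := filter_ex (filterI Fc Fd).
have := fK c y; rewrite distrC => h; rewrite -(subrKA (f y)).
apply: le_trans (ler_normD _ _) _; rewrite addrC lerD ?(ltW ly)//.
by apply: le_trans h _; rewrite ler_wpM2l ?(ltW K0)// ltW.
Qed.

Lemma Re_le_modulus (z : R[i]) : `|complex.Re z| <= modulus z.
Proof. by rewrite -lecR -normrC; exact: normc_ge_Re. Qed.

Lemma Im_le_modulus (z : R[i]) : `|complex.Im z| <= modulus z.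
Proof.
have := Re_le_modulus (z * 'i%C); rewrite ReiNIm normrN ComplexField.Normc.normcM.
by move=> h; apply: le_trans h _; rewrite /= expr0n expr1n add0r sqrtr1 mulr1.
Qed.

Lemma wc0_complete (F : set_system wc0) : ProperFilter F -> cauchy F -> cvg F.
Proof.
move=> FF cF; have p2 i : 0 < 2 ^+ i :> R by rewrite exprn_gt0.
have /choice[re reP] : forall i, exists l, forall c e, F (ball c e%:C) ->
    `|l - complex.Re (c i)| <= 2 ^+ i * e.
  move=> i; apply: (wc0_lipschitz_lim FF cF (f := fun c => complex.Re (c i)) (p2 i)) => c d.
  rewrite -raddfB /=; apply: le_trans (Re_le_modulus _) _.
  by rewrite mulrC; exact: (wnorm_coord (c - d)).
have /choice[im imP] : forall i, exists l, forall c e, F (ball c e%:C) ->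
    `|l - complex.Im (c i)| <= 2 ^+ i * e.
  move=> i; apply: (wc0_lipschitz_lim FF cF (f := fun c => complex.Im (c i)) (p2 i)) => c d.
  rewrite -raddfB /=; apply: le_trans (Im_le_modulus _) _.
  by rewrite mulrC; exact: (wnorm_coord (c - d)).
pose l i : R[i] := re i +i* im i.
have lP c e : F (ball c e%:C) -> forall i, modulus (l i - c i) <= 2 * e * 2 ^+ i.
  move=> Fc i; apply: le_trans (modulus_le _) _; rewrite !raddfB /=.
  by have := reP i c e Fc; have := imP i c e Fc; lra.
have Fball e : 0 < e -> exists c, F (ball c e%:C).
  by move=> e0; apply: (cauchyP F).1 => //; rewrite ltcR.
have lv : l \in vanishing_pred.
  apply/vanishing_predP => e e0.
  have e40 : 0 < e / 4 by rewrite divr_gt0.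
  have [c Fc] := Fball _ e40; have e20 : 0 < e / 2 by rewrite divr_gt0.
  have [N h] := (vanishing_predP _ (wvalP c)) _ e20.
  exists N => i /h ci; have := lP c _ Fc i.
  by have := modulusD (l i - c i) (c i); rewrite subrK; lra.
apply/cvg_ex; exists (Wc0 lv) => B /nbhs_nrP[e e0 eB].
have e40 : 0 < e / 4 by rewrite divr_gt0.
have [c Fc] := Fball _ e40; apply: filterS (Fc) => d /ball_nr cd; apply: eB.
apply: le_lt_trans (nr_dist _ c _) _.
suff : nr (Wc0 lv - c) <= 2 * (e / 4) by lra.
by rewrite nr_wnorm; apply: wnorm_le; exact: lP.
Qed.

HB.instance Definition _ := Uniform_isComplete.Build wc0 wc0_complete.

End WeightedC0.

(** * The backward shift *)

Section WeightedShift.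
Context (R : realType).
Local Notation W := (wc0 R).
Implicit Types (c d : W) (i n N : nat).

Lemma wshift_subproof c : (fun i => c i.+1) \in (@vanishing_pred R).
Proof.
apply/vanishing_predP => e e0; have e20 : 0 < e / 2 by rewrite divr_gt0.
have [N h] := (vanishing_predP _ (wvalP c)) _ e20.
exists N => i Ni; apply: le_trans (h i.+1 (leqW Ni)) _.
by rewrite exprS mulrA divfK.
Qed.

Definition wshift c : W := Wc0 (wshift_subproof c).

Lemma wshift_linear : linear wshift.
Proof. by move=> a c d; exact: wc0_ext. Qed.

HB.instance Definition _ := GRing.isLinear.Build R[i] W W *:%R wshift wshift_linear.

Lemma iter_wshift n c i : iter n wshift c i = c (n + i)%N.
Proof. by elim: n i => //= n IH i; rewrite IH addnS. Qed.

Lemma wshift_bounded : bounded_operator wshift.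
Proof.
exists 2 => c; rewrite !nrE -rmorphM lecR !nr_wnorm; apply: wnorm_le => i.
by apply: le_trans (wnorm_coord c i.+1) _; rewrite exprS mulrA [2 * _]mulrC.
Qed.

Lemma wfin_subproof (s : seq R[i]) : (fun i => nth 0 s i) \in (@vanishing_pred R).
Proof.
apply/vanishing_predP => e e0; exists (size s) => i si.
by rewrite nth_default// ComplexField.Normc.normc0 mulr_ge0 ?exprn_ge0 ?(ltW e0).
Qed.

Definition wfin (s : seq R[i]) : W := Wc0 (wfin_subproof s).

Definition rat_complex (q : rat * rat) : R[i] := ratr q.1 +i* ratr q.2.

Lemma rat_complex_approx (z : R[i]) e : 0 < e -> exists q, modulus (z - rat_complex q) <= e.
Proof.
move=> e0.
have approx (t : R) : exists q : rat, `|t - ratr q| <= e / 2.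
  have [|q] := @rat_in_itvoo R (t - e / 2) (t + e / 2); first by lra.
  by rewrite in_itv /= => /andP[h1 h2]; exists q; rewrite ler_norml; lra.
have [q1 h1] := approx (complex.Re z); have [q2 h2] := approx (complex.Im z).
exists (q1, q2); apply: le_trans (modulus_le _) _.
by rewrite !raddfB /=; lra.
Qed.

(** Truncate where the tail is small, then round the remaining coordinates. *)
Lemma wfin_approx c e : 0 < e ->
  exists s : seq (rat * rat), nr (c - wfin (map rat_complex s)) < e.
Proof.
move=> e0; have e20 : 0 < e / 2 by rewrite divr_gt0.
have [N h] := (vanishing_predP _ (wvalP c)) _ e20.
have /choice[q qP] : forall i, exists q, modulus (c i - rat_complex q) <= e / 2.
  by move=> i; exact: rat_complex_approx.
exists (mkseq q N); suff : nr (c - wfin (map rat_complex (mkseq q N))) <= e / 2 by lra.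
rewrite nr_wnorm; apply: wnorm_le => i /=.
rewrite -[_ i]/(c i - nth 0 (map rat_complex (mkseq q N)) i).
have [Ni|iN] := leqP N i.
  by rewrite nth_default ?subr0 ?h// size_map size_mkseq.
rewrite (nth_map (0, 0)) ?size_mkseq// nth_mkseq//.
apply: le_trans (qP i) _; rewrite ler_peMr ?(ltW e20)//.
by rewrite exprn_ege1// ler1n.
Qed.

Lemma wc0_separable : separable W.
Proof.
exists (range (fun s : seq (rat * rat) => wfin (map rat_complex s))).
  apply: sub_countable (countableP [set: seq (rat * rat)]).
  exact: card_image_le.
move=> O [c Oc] oO.
have /nbhs_nrP[e e0 eO] : nbhs c O by exact: open_nbhs_nbhs.
have [s cs] := wfin_approx c e0.
by exists (wfin (map rat_complex s)); split; [exact: eO|exists s].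
Qed.

Lemma wc0_sum n (k : 'I_n -> R[i]) (v : 'I_n -> W) i :
  (\sum_(j < n) k j *: v j) i = \sum_(j < n) k j * v j i.
Proof.
elim/big_rec2: _ => // j y1 y2 _ <-.
by [].
Qed.

(** The first [n + 1] coordinates of [n] spanning vectors would form a matrix of
rank [n + 1] with [n] rows. *)
Lemma wc0_infinite_dimensional : infinite_dimensional W.
Proof.
move=> n v hv.
pose A := \matrix_(i < n, j < n.+1) v i j.
have : row_full A.
  apply/row_fullP.
  have /choice[k kP] : forall p : 'I_n.+1, exists k : 'I_n -> R[i],
      forall j : 'I_n.+1, (p == j)%:R = \sum_(i < n) k i * v i j.
    move=> p; have [k kE] := hv (wfin (mkseq (fun j => (p == j :> nat)%:R) n.+1)).
    exists k => j; rewrite -wc0_sum -kE /= nth_mkseq//.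
  exists (\matrix_(p, i) k p i); apply/matrixP => p j.
  by rewrite !mxE kP; apply: eq_bigr => i _; rewrite !mxE.
rewrite /row_full => /eqP r; have := rank_leq_row A.
by rewrite r ltnn.
Qed.

Lemma coord0_continuous : continuous (fun c : W => modulus (c 0%N)).
Proof.
move=> c B /nbhs_ballP[e /= e0 eB]; apply/nbhs_nrP; exists e => // d cd; apply: eB.
rewrite /ball /=; apply: le_lt_trans cd.
have h1 : modulus (c 0%N - d 0%N) <= nr (c - d).
  by have := wnorm_coord (c - d) 0; rewrite expr0 mulr1.
have h2 : modulus (d 0%N - c 0%N) <= nr (c - d).
  by rewrite nr_distC; have := wnorm_coord (d - c) 0; rewrite expr0 mulr1.
have := modulusD (c 0%N - d 0%N) (d 0%N); have := modulusD (d 0%N - c 0%N) (c 0%N).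
rewrite !subrK ler_norml => k1 k2.
by apply/andP; split; lra.
Qed.

End WeightedShift.

(** * Vectors assembled from blocks along a hypercyclicity set *)

Lemma quartic_growth (R : realType) (D e : R) : 0 <= D -> 0 < e ->
  exists N, forall i, (N <= i)%N -> D * (i%:R + 1) ^+ 4 <= e * 2 ^+ i.
Proof.
move=> D0 e0.
(* The shift by 10 makes the induction step [(t + 11)^5 <= 2 (t + 10)^5] hold
   from the start. *)
pose Q : R := 11 ^+ 5.
have quintic i : (i.+1%:R + 10) ^+ 5 <= Q * 2 ^+ i :> R.
  elim: i => [|i IH]; first by rewrite expr0 mulr1 /Q; lra.
  rewrite [2 ^+ i.+1]exprS mulrCA; apply: (@le_trans _ _ (2 * (i.+1%:R + 10) ^+ 5)); last first.
    by rewrite ler_wpM2l.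
  rewrite -[i.+2%:R]natr1; move: (i.+1%:R : R) (ler0n R i.+1) => t t0.
  have t2 := exprn_ge0 2 t0; have t3 := exprn_ge0 3 t0; have t4 := exprn_ge0 4 t0.
  have t5 := exprn_ge0 5 t0; lra.
pose m : R := D * Q / e.
exists (Num.truncn m).+1 => i Ni.
have mi : m <= i%:R + 1.
  by apply: le_trans (ltW (truncnS_gt m)) _; rewrite natr1 ler_nat leqW.
have i1 : 0 < i%:R + 1 :> R by rewrite ltr_wpDl.
rewrite -(ler_pM2r i1) -mulrA -exprSr.
apply: (@le_trans _ _ (D * (Q * 2 ^+ i))).
  rewrite ler_wpM2l//; apply: le_trans (quintic i); rewrite ler_pXn2r ?nnegrE ?addr_ge0//.
  by rewrite -natr1; lra.
rewrite mulrA; move: mi; rewrite /m ler_pdivrMr// => mi.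
have p2 : 0 <= 2 ^+ i :> R by rewrite exprn_ge0.
by have := ler_wpM2r p2 mi; lra.
Qed.

(** The index [phi k] is the largest [j <= k] allowed by the bound, so repeating
terms slows [h] down to linear growth. *)
Lemma slow_subsequence (R : realType) (h : nat -> R) : (forall j, 0 <= h j) ->
  exists phi : nat -> nat, (forall k, h (phi k) <= (1 + h 0%N) * (k%:R + 1)) /\
    forall J, exists k0, forall k, (k0 <= k)%N -> (J <= phi k)%N.
Proof.
move=> h0; pose good k (j : 'I_k.+1) := h j <= (1 + h 0%N) * (k%:R + 1).
have good0 k : good k ord0.
  rewrite /good /=; have := h0 0%N; have := ler0n R k; nra.
exists (fun k => nat_of_ord [arg max_(j > ord0 | good k j) (j : nat)]); split=> [k|J].
  by case: arg_maxnP.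
exists (maxn J (Num.truncn (h J)).+1) => k; rewrite geq_max => /andP[Jk hk].
have Jk' : (J < k.+1)%N by rewrite ltnS.
case: arg_maxnP => // j _ /(_ (Ordinal Jk')); apply; rewrite /good /=.
have hJk : h J <= k%:R.
  by apply: le_trans (ltW (truncnS_gt _)) _; rewrite ler_nat.
by have := h0 0%N; have := ler0n R k; nra.
Qed.

Section Blocks.
Context (A : nat -> set nat).
Hypothesis A_disj : trivIset [set k : nat | (1 <= k)%N] A.
Hypothesis A_gap : forall k k' j j' : nat, (1 <= k)%N -> (1 <= k')%N ->
  A k j -> A k' j' -> j <> j' -> (maxn k k' <= `|j - j'|)%N.

Lemma block_gap k k' j j' : (1 <= k)%N -> (1 <= k')%N -> A k j -> A k' j' ->
  (j < j')%N -> (j + maxn k k' <= j')%N.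
Proof.
move=> k1 k1' Aj Aj' jj'; have := A_gap k1 k1' Aj Aj'.
have -> : (`|j - j'| = j' - j)%N by rewrite distnC distnEl// ltnW.
move=> /(_ _)-h; rewrite -(subnKC (ltnW jj')) leq_add2l; apply: h => jE.
by rewrite jE ltnn in jj'.
Qed.

Lemma block_uniq k k' j j' i i' : (1 <= k)%N -> (1 <= k')%N -> A k j -> A k' j' ->
  (i < k)%N -> (i' < k')%N -> (j + i = j' + i')%N -> k = k' /\ i = i'.
Proof.
move=> k1 k1' Aj Aj' ik ik' E.
have [jj'|jj'|jj'] := ltngtP j j'.
- have := block_gap k1 k1' Aj Aj' jj'; have := leq_maxl k k'; lia.
- have := block_gap k1' k1 Aj' Aj jj'; have := leq_maxl k' k; lia.
split; last by lia.
by apply: (A_disj k1 k1'); exists j; split=> //; rewrite jj'.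
Qed.

(** The blocks [[j, j + k)] with [j] in [A k] are pairwise disjoint by the gap
condition; outside of them the sequence takes the value [b]. *)
Lemma block_sequence (V : Type) (b : V) (beta : nat -> nat -> V) :
  exists c : nat -> V,
    (forall k j i, (1 <= k)%N -> A k j -> (i < k)%N -> c (j + i)%N = beta k i) /\
    forall n, c n = b \/
      exists k j i, [/\ (1 <= k)%N, A k j, (i < k)%N, n = (j + i)%N & c n = beta k i].
Proof.
have /choice[c cP] : forall n, exists v,
    (forall k j i, (1 <= k)%N -> A k j -> (i < k)%N -> n = (j + i)%N -> v = beta k i) /\
    (v = b \/ exists k j i, [/\ (1 <= k)%N, A k j, (i < k)%N, n = (j + i)%N & v = beta k i]).
  move=> n.
  have [[k [j [i [k1 Aj ik nE]]]]|none] :=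
    pselect (exists k j i, [/\ (1 <= k)%N, A k j, (i < k)%N & n = (j + i)%N]).
    exists (beta k i); split; last by right; exists k, j, i.
    move=> k' j' i' k1' Aj' ik' nE'.
    by have [-> ->] := block_uniq k1 k1' Aj Aj' ik ik' (etrans (esym nE) nE').
  exists b; split; last by left.
  by move=> k j i k1 Aj ik nE; case: none; exists k, j, i.
exists c; split=> [k j i k1 Aj ik|n]; last by have [_] := cP n.
by have [h _] := cP (j + i)%N; exact: (h k j i).
Qed.

(** A block of length [k'] met strictly after the one starting at [n] starts at
distance at least [k'] from [n], so the size of its entries is controlled by
their own position [i]. *)
Lemma block_tail k n i k' j i' : (1 <= k)%N -> (1 <= k')%N -> A k n -> A k' j ->
  (k <= i)%N -> (i' < k')%N -> (n + i = j + i')%N -> (k' <= i)%N.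
Proof.
move=> k1 k1' An Aj ki ik' E.
have [nj|jn|nj] := ltngtP n j.
- have := block_gap k1 k1' An Aj nj; have := leq_maxr k k'; lia.
- have := block_gap k1' k1 Aj An jn; have := leq_maxl k' k; lia.
have kk' : k = k' by apply: (A_disj k1 k1'); exists n; split=> //; rewrite nj.
lia.
Qed.

End Blocks.

Lemma pickle_unbounded (T : countType) (f : nat -> T) (k0 : nat) : injective f ->
  exists j, (k0 <= pickle (f j))%N.
Proof.
move=> fI; apply: contrapT => /forallNP h.
have lt j : (pickle (f j) < k0)%N by rewrite ltnNge; apply/negP; exact: h.
pose g (j : 'I_k0.+1) : 'I_k0 := Ordinal (lt j).
have : injective g.
  by move=> j j' /(congr1 val) /= /(pcan_inj pickleK)/fI/val_inj.
by move=> /leq_card; rewrite !card_ord ltnn.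
Qed.

Section ShiftVector.
Context (R : realType).
Local Notation W := (wc0 R).

(** Each rational finite sequence is listed infinitely often, and it is replaced
by the empty one as long as it exceeds the allowed length [k] or the allowed
size [th k]. *)
Lemma target_sequence (th : nat -> R) : (forall k, 0 <= th k) ->
  (forall M : R, exists k0, forall k, (k0 <= k)%N -> M <= th k) ->
  exists y : nat -> seq R[i], [/\ forall k, (size (y k) <= k)%N,
    forall k i, modulus (nth 0 (y k) i) <= th k
  & forall (z : W) (e : R) k0, 0 < e -> exists2 k, (k0 <= k)%N & nr (z - wfin (y k)) < e].
Proof.
move=> th0 thoo.
pose s k : seq R[i] := if @unpickle (seq (rat * rat) * nat)%type k is Some q
  then map (@rat_complex R) q.1 else [::].
pose valid k := (size (s k) <= k)%N && all (fun z => modulus z <= th k) (s k).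
exists (fun k => if valid k then s k else [::]); split=> [k|k i|z e k0 e0].
- by rewrite /valid; case: ifP => // /andP[].
- have [/andP[_ /allP h]|_] := ifPn (valid k); last by rewrite nth_nil ComplexField.Normc.normc0.
  have [ik|ik] := ltnP i (size (s k)); first by apply: h; exact: mem_nth.
  by rewrite nth_default// ComplexField.Normc.normc0.
have [q zq] := wfin_approx z e0.
set t := map _ q in zq.
have [M tM] : exists M : R, forall u, u \in t -> modulus u <= M.
  exists (\sum_(u <- t) modulus u) => u ut.
  by rewrite (big_rem u)//= lerDl sumr_ge0// => v _; exact: modulus_ge0.
have [k1 k1P] := thoo M.
have [j jk] := @pickle_unbounded _ (fun j => (q, j)) (maxn k0 (maxn k1 (size t)))
  (fun j j' E => congr1 snd E).
exists (pickle (q, j)); first by apply: leq_trans jk; rewrite leq_maxl.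
move: jk; rewrite !geq_max => /and3P[_ jk1 jt].
have sE : s (pickle (q, j)) = t by rewrite /s pickleK.
have -> : valid (pickle (q, j)).
  rewrite /valid sE jt; apply/allP => u /tM uM; apply: le_trans uM _; exact: k1P.
by rewrite sE.
Qed.

(** The vector [c] carries [beta k] on each block starting in [A k] and [b]
elsewhere.  For [n] in [A k], the shifted vector [lam k *: T^n c] agrees with
[y k] on the first [k] coordinates up to the error between [lam k * beta k i]
and [y k]; from coordinate [i >= k] on, it is bounded by a quartic in [i],
negligible against [2^i].  The entries of [c] are the zeroth coordinates of
its orbit, which is why they are described in the conclusion. *)
Lemma shift_vector (F : set (set nat)) (Gam : set R[i]) (lam : nat -> R[i])
    (beta : nat -> nat -> R[i]) (b : R[i]) (y : nat -> seq R[i]) (C : R) :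
  hypercyclicity_set F -> 0 <= C ->
  (forall k, Gam (lam k)) ->
  (forall k, (size (y k) <= k)%N) ->
  (forall k, modulus (lam k) <= C * (k%:R + 1) ^+ 2) ->
  (forall k i, modulus (beta k i) <= C * (k%:R + 1) ^+ 2) ->
  modulus b <= C ->
  (forall e, 0 < e -> exists k0, forall k i, (k0 <= k)%N -> (i < k)%N ->
     modulus (nth 0 (y k) i - lam k * beta k i) <= e) ->
  (forall (z : W) (e : R) k0, 0 < e -> exists2 k, (k0 <= k)%N & nr (z - wfin (y k)) < e) ->
  exists c : W, hypercyclic_vector F Gam (@wshift R) c /\
    forall n, c n = b \/ exists k i, c n = beta k i.
Proof.
move=> [[F0 _ upF] [A [FA A_disj A_gap]]] C0 lamG ysize lamC betaC bC ybeta ydense.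
have [c [cA cb]] := block_sequence A_disj A_gap b beta.
pose p (k : nat) : R := C * (k%:R + 1) ^+ 2.
have p_mono k i : (k <= i)%N -> p k <= p i.
  by move=> ki; rewrite ler_wpM2l// ler_pXn2r ?nnegrE ?addr_ge0// lerD2r ler_nat.
have Cp i : C <= p i.
  by rewrite /p ler_peMr// exprn_ege1// lerDr.
have tail k n i : (1 <= k)%N -> A k n -> (k <= i)%N -> modulus (c (n + i)%N) <= p i.
  move=> k1 An ki; have [->|[k' [j [i' [k1' Aj ik' E ->]]]]] := cb (n + i)%N.
    exact: le_trans bC _.
  apply: le_trans (betaC _ _) _; apply: p_mono.
  exact: (block_tail A_disj A_gap k1 k1' An Aj ki ik' E).
have growth (e : R) : 0 < e -> exists N, forall i, (N <= i)%N -> p i <= e * 2 ^+ i.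
  move=> e0; have [N h] := quartic_growth C0 e0; exists N => i /h.
  apply: le_trans; rewrite ler_wpM2l//.
  by rewrite ler_weXn2l// lerDr.
have [j0 Aj0] : A 1%N !=set0.
  by apply/set0P/eqP => E; have := FA 1%N isT; rewrite E.
have cv : c \in @vanishing_pred R.
  apply/vanishing_predP => e e0; have [N h] := growth e e0.
  exists (j0 + N.+1)%N => n nN.
  have nE : n = (j0 + (n - j0))%N by lia.
  rewrite nE; apply: le_trans (tail 1%N j0 (n - j0)%N isT Aj0 _) _; first by lia.
  apply: le_trans (h _ _) _; first by lia.
  by rewrite ler_pM2l// ler_eXn2l ?ltr1n//; lia.
exists (Wc0 cv); split; last first.
  by move=> n; have [|[k [_ [i [_ _ _ _ E]]]]] := cb n; [left|right; exists k, i].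
move=> U oU [z Uz].
have /nbhs_nrP[e e0 eU] : nbhs z U by exact: open_nbhs_nbhs.
have e20 : 0 < e / 2 by rewrite divr_gt0.
have e40 : 0 < e / 4 by rewrite divr_gt0.
have [k0 k0P] := ybeta _ e40.
have [k1 k1P] := quartic_growth (mulr_ge0 C0 C0) e40.
have [k] := ydense z _ (maxn 1 (maxn k0 k1)) e20.
rewrite !geq_max => /and3P[kp kk0 kk1] zk.
apply: upF (FA k kp) => n An.
exists (iter n (@wshift R) (lam k *: Wc0 cv)); split; last first.
  apply: eU; apply: le_lt_trans (nr_dist _ (wfin (y k)) _) _.
  suff : nr (wfin (y k) - iter n (@wshift R) (lam k *: Wc0 cv)) <= e / 4 by lra.
  rewrite iter_linearZ nr_wnorm; apply: wnorm_le => i.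
  rewrite -[_ i]/(nth 0 (y k) i - lam k * iter n (@wshift R) (Wc0 cv) i) iter_wshift /=.
  have [ik|ki] := ltnP i k.
    rewrite (cA k n i kp An ik); apply: le_trans (k0P _ _ kk0 ik) _.
    by rewrite ler_peMr ?(ltW e40)// exprn_ege1// ler1n.
  rewrite nth_default; last exact: leq_trans (ysize k) ki.
  rewrite sub0r normcN ComplexField.Normc.normcM.
  apply: le_trans (k1P i (leq_trans kk1 ki)).
  have -> : C * C * (i%:R + 1) ^+ 4 = p i * p i by rewrite /p; ring.
  rewrite ler_pM ?modulus_ge0//; last exact: tail An ki.
  exact: le_trans (lamC k) (p_mono _ _ ki).
by exists (lam k *: Wc0 cv) => //; exists (lam k).
Qed.

End ShiftVector.

(** * What an F-hypercyclic scalar set must satisfy *)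

Section ScalarSetNecessary.
Context (R : realType) (F : set (set nat)) (Gamma : set R[i]).
Hypothesis hF : hypercyclicity_set F.
Hypothesis hS : hypercyclic_scalar_set F Gamma.
Local Notation W := (wc0 R).
Local Notation T := (@wshift R).

Lemma shift_scalar_set (c : W) :
  hypercyclic_vector F Gamma T c <-> hypercyclic_vector F [set 1] T c.
Proof.
exact: (hS (Y := W) (@wc0_separable R) (@wc0_infinite_dimensional R)
  (S := T) (@wshift_bounded R) c).
Qed.

Lemma hypercyclic_hits (X : normedModType R[i]) (S : {linear X -> X}) (Gam : set R[i])
    (x : X) (U : set X) : hypercyclic_vector F Gam S x -> open U -> U !=set0 ->
  exists n a, Gam a /\ U (a *: iter n S x).
Proof.
move=> hx oU U0; case: hF => -[F0 _ _] _.
have := hx U oU U0; set E := [set n | _] => FE.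
have [n [_ [[_ [a Ga <-] <-] Uz]]] : E !=set0.
  by apply/set0P/eqP => E0; rewrite E0 in FE.
by exists n, a; split=> //; rewrite -iter_linearZ.
Qed.

Lemma coord0_open (V : set R) : open V -> open [set c : W | V (modulus (c 0%N))].
Proof. by move=> oV; apply: open_comp => // c _; exact: coord0_continuous. Qed.

Lemma succ_ge0 (k : nat) : 0 <= k%:R + 1 :> R.
Proof. by rewrite addr_ge0. Qed.

Lemma succ_unbounded (M : R) : exists k0, forall k : nat, (k0 <= k)%N -> M <= k%:R + 1.
Proof.
exists (Num.truncn M).+1 => k h; apply: (@le_trans _ _ k%:R); last by rewrite lerDl.
by apply: le_trans (ltW (truncnS_gt M)) _; rewrite ler_nat.
Qed.

Lemma le_succ_sqr (C : R) (k : nat) : 0 <= C -> C * (k%:R + 1) <= C * (k%:R + 1) ^+ 2.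
Proof.
by move=> C0; rewrite ler_wpM2l// expr2 ler_peMr ?succ_ge0// lerDr.
Qed.

(** The shift has an F-hypercyclic vector, whereas the orbit scaled by 0 alone
stays at 0. *)
Lemma scalar_set_neq0 : Gamma `\ 0 !=set0.
Proof.
apply: contrapT => G0.
have [y [ysize yth ydense]] := target_sequence succ_ge0 succ_unbounded.
have [c [hc _]] : exists c : W, hypercyclic_vector F [set 1] T c /\
    forall n, c n = 0 \/ exists k i, c n = nth 0 (y k) i.
  apply: (@shift_vector R F [set 1] (fun=> 1) (fun k i => nth 0 (y k) i) 0 y 1) => //.
  - move=> k; rewrite ComplexField.Normc.normc1 mul1r exprn_ege1// lerDr//.
  - move=> k i; apply: le_trans (yth k i) _.
    by have := @le_succ_sqr 1 k ler01; rewrite !mul1r.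
  - by rewrite ComplexField.Normc.normc0.
  - move=> e e0; exists 0%N => k i _ _.
    by rewrite mul1r subrr ComplexField.Normc.normc0 ltW.
have [||n [a [Ga]]] := hypercyclic_hits ((shift_scalar_set c).2 hc)
  (U := [set v : W | 0 < modulus (v 0%N)]).
- exact: (@coord0_open [set t | 0 < t] (@open_gt R 0)).
- by exists (wfin [:: 1]); change (0 < modulus (1 : R[i])); rewrite ComplexField.Normc.normc1.
have -> : a = 0 by apply: contrapT => a0; apply: G0; exists a.
rewrite scale0r; change (0 < modulus (0 : R[i]) -> False).
by rewrite ComplexField.Normc.normc0 ltxx.
Qed.

(** With scalars of modulus tending slowly to infinity, targets [y k] that
[lam k] dominates have all entries [y k / lam k] of modulus at most 1, so that
the unscaled orbit never meets the vectors whose zeroth coordinate has modulus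
larger than 1. *)
Lemma scalar_set_bounded : modulus_bounded (Gamma `\ 0).
Proof.
apply: contrapT => unb.
have /choice[mu muP] : forall j : nat, exists z, (Gamma `\ 0) z /\ j%:R + 1 <= modulus z.
  move=> j; apply: contrapT => /forallNP h; apply: unb; exists (j%:R + 1) => z Gz.
  by rewrite leNgt; apply/negP => /ltW jz; apply: (h z).
have [phi [phiC phioo]] := slow_subsequence (fun j => modulus_ge0 (mu j)).
set C : R := 1 + _ in phiC.
have C1 : 1 <= C by rewrite lerDl modulus_ge0.
have C0 : 0 <= C by apply: le_trans C1.
pose lam k := mu (phi k).
have lam0 k : 0 < modulus (lam k).
  by have [_] := muP (phi k); apply: lt_le_trans; rewrite ltr_wpDl.
have lam0' k : lam k != 0 by rewrite -modulus_gt0.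
have lamoo (M : R) : exists k0, forall k, (k0 <= k)%N -> M <= modulus (lam k).
  have [J hJ] := succ_unbounded M; have [k0 h0] := phioo J.
  exists k0 => k /h0/hJ h; apply: le_trans h _; by case: (muP (phi k)).
have [y [ysize yth ydense]] := target_sequence (fun k => ltW (lam0 k)) lamoo.
have beta1 k i : modulus (nth 0 (y k) i / lam k) <= 1.
  rewrite ComplexField.Normc.normcM ComplexField.Normc.normcV ler_pdivrMr// mul1r.
  exact: yth.
have [c [hc cE]] : exists c : W, hypercyclic_vector F Gamma T c /\
    forall n, c n = 0 \/ exists k i, c n = nth 0 (y k) i / lam k.
  apply: (@shift_vector R F Gamma lam (fun k i => nth 0 (y k) i / lam k) 0 y C) => //.
  - by move=> k; case: (muP (phi k)) => -[].
  - by move=> k; apply: le_trans (phiC k) _; exact: le_succ_sqr.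
  - move=> k i; apply: le_trans (beta1 k i) _; apply: le_trans C1 _.
    by rewrite ler_peMr// exprn_ege1// lerDr.
  - by rewrite ComplexField.Normc.normc0.
  - move=> e e0; exists 0%N => k i _ _.
    by rewrite mulrC divfK// subrr ComplexField.Normc.normc0 ltW.
have [||n [_ [->]]] := hypercyclic_hits ((shift_scalar_set c).1 hc)
  (U := [set v : W | 1 < modulus (v 0%N)]).
- exact: (@coord0_open [set t | 1 < t] (@open_gt R 1)).
- exists (wfin [:: 2%:C]); change (1 < modulus (2%:C : R[i])); rewrite modulus_real.
  by rewrite gtr0_norm// ltr1n.
rewrite scale1r /= iter_wshift addn0 ltNge => /negP; apply.
have [->|[k [i ->]]] := cE n; first by rewrite ComplexField.Normc.normc0.
exact: beta1.
Qed.

(** With scalars tending slowly to 0, entries [y k / lam k] of modulus below 1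
can be replaced by 1, which changes [lam k * beta k] by at most
[2 * `|lam k|]; filling the remaining places with 1, the zeroth coordinate of
the orbit never has modulus smaller than 1. *)
Lemma scalar_set_calC0 (alpha : nat -> R[i]) : ~ calC0 Gamma alpha.
Proof.
move=> [aG adec alim].
have a0 k : 0 < modulus (alpha k).
  by apply: le_lt_trans (adec k); exact: modulus_ge0.
have amono j k : (j <= k)%N -> modulus (alpha k) <= modulus (alpha j).
  move=> /subnKC <-; elim: (k - j)%N => [|d IH]; first by rewrite addn0.
  by rewrite addnS; apply: le_trans IH; exact: ltW.
have [phi [phiC phioo]] := slow_subsequence (fun j => ltW (divr_gt0 ltr01 (a0 j))).
pose C : R := 1 + 1 / modulus (alpha 0%N) + modulus (alpha 0%N).
have ia0 : 0 <= 1 / modulus (alpha 0%N) by rewrite divr_ge0// modulus_ge0.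
have C1 : 1 <= C by rewrite /C -addrA lerDl addr_ge0// modulus_ge0.
have C0 : 0 <= C by apply: le_trans C1.
pose lam k := alpha (phi k).
have lam0 k : 0 < modulus (lam k) by exact: a0.
have lam0' k : lam k != 0 by rewrite -modulus_gt0.
have [y [ysize yth ydense]] := target_sequence succ_ge0 succ_unbounded.
pose beta k i := let v := nth 0 (y k) i / lam k in if 1 <= modulus v then v else 1.
have beta1 k i : 1 <= modulus (beta k i).
  by rewrite /beta; case: ifPn => // _; rewrite ComplexField.Normc.normc1.
have [c [hc cE]] : exists c : W, hypercyclic_vector F Gamma T c /\
    forall n, c n = 1 \/ exists k i, c n = beta k i.
  apply: (@shift_vector R F Gamma lam beta 1 y C) => //.
  - by move=> k; exact: aG.
  - move=> k; apply: le_trans (amono _ _ (leq0n _)) _.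
    apply: (@le_trans _ _ C); first by rewrite /C lerDr addr_ge0.
    by rewrite ler_peMr// exprn_ege1// lerDr.
  - move=> k i; rewrite /beta; case: ifPn => _; last first.
      rewrite ComplexField.Normc.normc1; apply: le_trans C1 _.
      by rewrite ler_peMr// exprn_ege1// lerDr.
    rewrite ComplexField.Normc.normcM ComplexField.Normc.normcV -div1r.
    have -> : C * (k%:R + 1) ^+ 2 = (k%:R + 1) * (C * (k%:R + 1)) by ring.
    apply: ler_pM; rewrite ?modulus_ge0 ?divr_ge0 ?modulus_ge0//.
    apply: le_trans (phiC k) _; rewrite ler_wpM2r ?succ_ge0// /C lerDl.
    exact: modulus_ge0.
  - by rewrite ComplexField.Normc.normc1.
  - move=> e e0; have e20 : 0 < e / 2 by rewrite divr_gt0.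
    have : \forall k \near \oo, modulus (alpha k) < e / 2.
      have /cvgrPdist_lt/(_ _ e20) := alim; apply: filterS => k.
      by rewrite sub0r normrN ger0_norm ?modulus_ge0.
    move=> [J _ hJ]; have [k0 h0] := phioo J.
    exists k0 => k i /h0/hJ /= lk _; rewrite /beta; case: ifPn => [_|].
      by rewrite mulrC divfK// subrr ComplexField.Normc.normc0 ltW.
    rewrite -ltNge ComplexField.Normc.normcM ComplexField.Normc.normcV.
    rewrite ltr_pdivrMr// mul1r mulr1 => yl.
    apply: le_trans (modulusD _ _) _; rewrite normcN.
    by move: lk yl; rewrite -/(lam k); lra.
have [||n [_ [->]]] := hypercyclic_hits ((shift_scalar_set c).1 hc)
  (U := [set v : W | modulus (v 0%N) < 1]).
- exact: (@coord0_open [set t | t < 1] (@open_lt R 1)).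
- by exists (wfin [::]); change (modulus (0 : R[i]) < 1); rewrite ComplexField.Normc.normc0.
rewrite scale1r /= iter_wshift addn0 ltNge => /negP; apply.
by have [->|[k [i ->]]] := cE n; [rewrite ComplexField.Normc.normc1|exact: beta1].
Qed.

End ScalarSetNecessary.

Theorem theorem5p1 (R : realType) (Gamma : set R[i]) (F : set (set nat))
    (hF : hypercyclicity_set F) :
  (* (ii) => (iii) *)
  (hypercyclic_scalar_set F Gamma ->
     [/\ Gamma `\ 0 !=set0, modulus_bounded (Gamma `\ 0)
       & calC0 Gamma `<=` calR Gamma]) /\
  (* (i) => (ii) under the additional hypotheses *)
  (right_invariant F -> finite_union_closed (~` F) ->
     [/\ Gamma `\ 0 !=set0, modulus_bounded (Gamma `\ 0)
       & modulus_bounded_away_from_zero (Gamma `\ 0)] ->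
     hypercyclic_scalar_set F Gamma).
Proof.
split=> [hS|riF fuF [[l [Gl /= l0]] [M hM] [m m0 hm]] Y _ infY S bS y].
  split; [exact: scalar_set_neq0 hF hS|exact: scalar_set_bounded hF hS|].
  by move=> alpha /(scalar_set_calC0 hF hS).
have ff : furstenberg_family F by case: hF.
have cS := bounded_operator_continuous bS.
have [e e0] := infinite_dimensional_neq0 infY.
have M0 : 0 < M.
  by apply: lt_le_trans m0 _; apply: (@le_trans _ _ (modulus l)); [exact: hm|exact: hM].
have ann : (Gamma `\ 0) `<=` annulus m M.
  by move=> z Gz; apply/andP; split; [exact: hm|exact: hM].
split; first exact: (hypercyclic_vector_point ff cS e0 m0 M0 ann riF fuF).
by apply: (hypercyclic_vector_of_point ff Gl); apply/eqP.
Qed.
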